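(* Let $n\ge2$ and $X=[T^*\mathbb{C}/\mathbb{Z}_n]$. There are exactly $n$ inequivalent prequantum sectors on $X$, i.e. isomorphism classes of prequantum line bundles (Hermitian orbifold line bundles with unitary orbifold connection of curvature $-\frac{i}{\hbar}\omega$), indexed by $a\in\{0,1,\dots,n-1\}$. Fixing one prequantum bundle $(L_0,\nabla_0)$, the sector $L_a$ is obtained by tensoring with the flat orbifold line bundle $F_a$ determined by the character $\chi_a(g)=e^{2\pi i a/n}$ of $\mathbb{Z}_n=\langle g\rangle$. This changes only the torsion equivariant data and leaves the curvature unchanged.
   Context: $\mathbb{Z}_n=\langle g\mid g^n=1\rangle$ acts on $\mathbb{C}\cong\mathbb{R}^2$ by $g\cdot z=e^{2\pi i/n}z$ and on $T^*\mathbb{C}\cong\mathbb{R}^4$, with coordinates $(x,y,p_x,p_y)$, by the cotangent lift (the same planar rotation on position and momentum). The symplectic form is $\omega=dp_x\wedge dx+dp_y\wedge dy$, which is invariant. Orbifold line bundles with connection on the global quotient $[M/G]$ are $G$-equivariant line bundles with $G$-equivariant connection on $M$, and isomorphisms are $G$-equivariant unitary connection-preserving isomorphisms. The flat bundle $F_a$ is the trivial bundle $T^*\mathbb{C}\times\mathbb{C}$ with connection $d$ and with $g$ acting on the fiber by multiplication by $e^{2\pi i a/n}$. $\hbar>0$ is fixed. *)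

(* Defs.v *)
From HB Require Import structures.
From mathcomp Require Import all_boot all_order all_algebra.
From mathcomp Require Import sesquilinear.
From mathcomp Require Import all_classical all_reals all_analysis.
From mathcomp.real_closed Require Import complex.

Set Implicit Arguments.
Unset Strict Implicit.
Unset Printing Implicit Defensive.

Import Order.TTheory GRing.Theory Num.Theory.
Import numFieldNormedType.Exports.

Local Open Scope classical_set_scope.
Local Open Scope complex_scope.
Local Open Scope ring_scope.

(* [T^*C = R^4] with coordinates [(x, y, p_x, p_y)], numbered from [0] to [3];
   tangent vectors and constant vector fields are elements of the same space. *)
Notation phase R := 'rV[R]_4.

Section PhaseSpace.
Variable R : realType.

Definition cx : 'I_4 := @Ordinal 4 0 isT.
Definition cy : 'I_4 := @Ordinal 4 1 isT.
Definition cpx : 'I_4 := @Ordinal 4 2 isT.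
Definition cpy : 'I_4 := @Ordinal 4 3 isT.

(* [dp_x /\ dx + dp_y /\ dy], with
   [(al /\ be)(u, v) = al(u) be(v) - al(v) be(u)]. *)
Definition omega (u v : phase R) : R :=
  (u 0 cpx * v 0 cx - v 0 cpx * u 0 cx) +
  (u 0 cpy * v 0 cy - v 0 cpy * u 0 cy).

(* [exp (2 i pi m / n) = cos (angle n m) + i sin (angle n m)] *)
Definition angle (n m : nat) : R := 2 * pi * m%:R / n%:R.

Definition unit_root (n m : nat) : R[i] :=
  cos (angle n m) +i* sin (angle n m).

(* The action of [g ^ k]: the rotation of angle [2 pi k / n] on position and on
   momentum. *)
Definition rotation (n : nat) (k : 'Z_n) (z : phase R) : phase R :=
  let c := cos (angle n k) in let s := sin (angle n k) in
  \row_(j < 4) [:: c * z 0 cx - s * z 0 cy; s * z 0 cx + c * z 0 cy;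
                   c * z 0 cpx - s * z 0 cpy; s * z 0 cpx + c * z 0 cpy]`_j.

(* C^oo on an open set: the iterated directional derivatives of all orders
   exist and are continuous. *)
Definition smooth_on (U : set (phase R)) (f : phase R -> R) : Prop :=
  forall (vs : seq (phase R)) (x : phase R), U x ->
    let g := foldr (fun v h => 'D_v h) f vs in
    {for x, continuous g} /\ forall v, derivable g x v.

Definition csmooth_on (U : set (phase R)) (f : phase R -> R[i]) : Prop :=
  smooth_on U (fun x => complex.Re (f x)) /\
  smooth_on U (fun x => complex.Im (f x)).

Definition cderive (v : phase R) (f : phase R -> R[i]) (x : phase R) : R[i] :=
  'D_v (fun y => complex.Re (f y)) x +i* 'D_v (fun y => complex.Im (f y)) x.

End PhaseSpace.

Section Bundles.
Variable R : realType.
Local Notation C := R[i].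
Local Notation V := (phase R).

(* The data of a Hermitian line bundle with connection over [R^4]. [herm] is
   linear in its first argument. [frame U e] says that the restriction of [e] to
   [U] belongs to the atlas of local unitary frames defining the smooth
   structure. [nabla v s] is the covariant derivative of [s] along the constant
   field [v]; along a field [X] it is [nabla (X x) s x] at [x]. Sections over an
   open set are represented by total ones, with junk values outside that set;
   the values of [nabla] where a section is not smooth are irrelevant. *)
Record line_bundle := LineBundle {
  fib : V -> vectType C;
  herm : forall x, {dot fib x for @Num.conj C};
  frame : set V -> (forall x, fib x) -> Prop;
  nabla : V -> (forall x, fib x) -> forall x, fib x }.

Definition section (L : line_bundle) : Type := forall x, fib L x.

(* A section is smooth when its coefficients in the local frames are. *)
Definition smooth_section (L : line_bundle) (U : set V) (s : section L) :=
  forall W e, frame W e -> csmooth_on (U `&` W) (fun x => herm L x (s x) (e x)).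

Record is_line_bundle (L : line_bundle) : Prop := {
  fib_line : forall x, \dim {: fib L x} = 1%N;
  frame_open : forall U (e : section L), frame U e -> open U;
  frame_unit : forall U (e : section L), frame U e ->
    forall x, U x -> herm L x (e x) (e x) = 1;
  frame_cover : forall x, exists U, exists e : section L, frame U e /\ U x;
  (* the transition functions are smooth *)
  frame_smooth : forall U (e : section L), frame U e -> smooth_section U e;
  nabla_smooth : forall U (s : section L) v, open U -> smooth_section U s ->
    smooth_section U (nabla v s);
  nabla_local : forall U (s t : section L) v, open U -> smooth_section U s ->
    (forall x, U x -> s x = t x) -> forall x, U x -> nabla v s x = nabla v t x;
  nabla_add : forall U (s t : section L) v, open U ->
    smooth_section U s -> smooth_section U t ->
    forall x, U x -> nabla v (fun y => s y + t y) x = nabla v s x + nabla v t x;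
  nabla_Leibniz : forall U (f : V -> C) (s : section L) v, open U ->
    csmooth_on U f -> smooth_section U s ->
    forall x, U x -> nabla v (fun y => f y *: s y) x =
                     cderive v f x *: s x + f x *: nabla v s x;
  nabla_linear : forall U (s : section L) (a : R) u v, open U ->
    smooth_section U s ->
    forall x, U x -> nabla (a *: u + v) s x = a%:C *: nabla u s x + nabla v s x;
  nabla_unitary : forall U (s t : section L) v, open U ->
    smooth_section U s -> smooth_section U t ->
    forall x, U x -> cderive v (fun y => herm L y (s y) (t y)) x =
                     herm L x (nabla v s x) (t x) + herm L x (s x) (nabla v t x)
}.

(* The curvature is evaluated on constant fields, whose brackets vanish. *)
Definition has_curvature (L : line_bundle) (F : V -> V -> V -> C) : Prop :=
  forall U (s : section L), open U -> smooth_section U s ->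
    forall x, U x -> forall u v,
      nabla u (nabla v s) x - nabla v (nabla u s) x = F x u v *: s x.

(* Unitary connection-preserving bundle maps covering a diffeomorphism [f] of
   the base. Sections [s] and [t] with [t (f x) = Phi x (s x)] correspond to
   each other under [Phi]; ['D_v f x] is the image of [v] under the differential
   of [f] at [x]. Such a map is bijective, being isometric between lines. *)
Record is_bundle_map (L L' : line_bundle) (f : V -> V)
    (Phi : forall x, fib L x -> fib L' (f x)) : Prop := {
  map_linear : forall x, linear (Phi x);
  map_unitary : forall x u v, herm L' (f x) (Phi x u) (Phi x v) = herm L x u v;
  map_smooth : forall U (s : section L) (t : section L'), open U ->
    (forall x, U x -> t (f x) = Phi x (s x)) ->
    smooth_section U s -> smooth_section (f @` U) t;
  map_parallel : forall U (s : section L) (t : section L'), open U ->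
    (forall x, U x -> t (f x) = Phi x (s x)) -> smooth_section U s ->
    forall x, U x -> forall v, nabla ('D_v f x) t (f x) = Phi x (nabla v s x)
}.

Record eq_line_bundle (n : nat) := EqLineBundle {
  bundle :> line_bundle;
  lift_action : forall (k : 'Z_n) (x : V),
    fib bundle x -> fib bundle (rotation k x) }.

Definition total_point (L : line_bundle) (x : V) (u : fib L x) :
  {y : V & fib L y} := existT (fun y => fib L y : Type) x u.

(* Equality in the total space avoids transporting along
   [rotation (k + l) x = rotation k (rotation l x)]. *)
Record is_eq_line_bundle (n : nat) (E : eq_line_bundle n) : Prop := {
  eq_bundle : is_line_bundle E;
  lift_0 : forall x (u : fib E x),
    total_point (lift_action 0 u) = total_point u;
  lift_D : forall (k l : 'Z_n) x (u : fib E x),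
    total_point (lift_action (k + l) u) =
    total_point (lift_action k (lift_action l u));
  lift_map : forall k : 'Z_n,
    @is_bundle_map E E (rotation k) (@lift_action n E k) }.

Definition eq_iso (n : nat) (E E' : eq_line_bundle n) : Prop :=
  exists Phi : forall x, fib E x -> fib E' x,
    @is_bundle_map E E' id Phi /\
    forall (k : 'Z_n) x (u : fib E x),
      Phi (rotation k x) (lift_action k u) = lift_action k (Phi x u).

(* [T] is the tensor product of [E] and [E'], [m x u u'] being [u (x) u'].
   Since [m x] is bilinear, multiplicative for the metrics, and its source and
   target are lines, it is a universal bilinear map. *)
Definition is_tensor (n : nat) (E E' T : eq_line_bundle n) : Prop :=
  is_eq_line_bundle T /\
  exists m : forall x, {bilinear fib E x -> fib E' x -> fib T x},
    [/\ forall x (u v : fib E x) (u' v' : fib E' x),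
          herm T x (m x u u') (m x v v') = herm E x u v * herm E' x u' v',
        forall U (s : section E) (s' : section E'), open U ->
          smooth_section U s -> smooth_section U s' ->
          @smooth_section T U (fun x => m x (s x) (s' x)),
        forall U (s : section E) (s' : section E'), open U ->
          smooth_section U s -> smooth_section U s' -> forall v x, U x ->
          @nabla T v (fun y => m y (s y) (s' y)) x =
          m x (nabla v s x) (s' x) + m x (s x) (nabla v s' x) &
        forall (k : 'Z_n) x (u : fib E x) (u' : fib E' x),
          lift_action k (m x u u') =
          m (rotation k x) (lift_action k u) (lift_action k u')].

Definition cdot (u v : C^o) : C := u * Num.conj v.

Fact cdot_is_bilinear :
  bilinear_for (GRing.Scale.Law.clone _ _ ( *%R ) _)
    (GRing.Scale.Law.clone _ _ (@Num.conj C \; *%R) _) cdot.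
Proof.
split=> [u' a x y|u a x y] /=; rewrite /cdot.
  by rewrite mulrDl /= -mulrA.
by rewrite rmorphD rmorphM mulrDr /= mulrCA.
Qed.

HB.instance Definition _ :=
  bilinear_isBilinear.Build C C^o C^o C *%R (@Num.conj C \; *%R)
    cdot cdot_is_bilinear.

Fact cdot_hermitian (u v : C^o) : cdot u v = (-1) ^+ false * (cdot v u)^*%R.
Proof. by rewrite /cdot expr0 mul1r rmorphM /= conjCK mulrC. Qed.

HB.instance Definition _ :=
  isHermitianSesquilinear.Build C C^o false (@Num.conj C) cdot cdot_hermitian.

Fact cdot_gt0 (u : C^o) : u != 0 -> 0 < cdot u u.
Proof. by move=> u0; rewrite /cdot -normCK exprn_gt0 // normr_gt0. Qed.

HB.instance Definition _ :=
  isDotProduct.Build C C^o cdot cdot_gt0.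

Definition trivial_bundle : line_bundle :=
  {| fib := fun _ => C^o : vectType C;
     herm := fun _ => cdot : {dot C^o for @Num.conj C};
     frame := fun U e => U = setT /\ e = (fun=> 1);
     nabla := fun v s x => cderive v s x |}.

(* The flat bundle [F_a], on which [g ^ k] acts by [exp (2 i pi a k / n)]. *)
Definition flat_bundle (n a : nat) : eq_line_bundle n :=
  @EqLineBundle n trivial_bundle
    (fun k _ (u : C^o) => unit_root R n (a * k)%N * u).

(* [T] is isomorphic to the [m]-th tensor power of [E]. *)
Fixpoint is_tensor_power (n : nat) (E : eq_line_bundle n) (m : nat)
    (T : eq_line_bundle n) : Prop :=
  match m with
  | 0 => eq_iso T (flat_bundle n 0)
  | m'.+1 => exists T', is_tensor_power E m' T' /\ is_tensor T' E T
  end.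

Definition is_prequantum (hbar : R) (n : nat) (E : eq_line_bundle n) : Prop :=
  is_eq_line_bundle E /\
  has_curvature E (fun _ u v => - 'i%C / hbar%:C * (omega u v)%:C).

(* [S] lists every isomorphism class of prequantum bundles exactly once. *)
Definition lists_sectors (hbar : R) (n : nat)
    (S : 'I_n -> eq_line_bundle n) : Prop :=
  [/\ forall a, is_prequantum hbar (S a),
      forall a b, eq_iso (S a) (S b) -> a = b &
      forall E, is_prequantum hbar E -> exists a, eq_iso E (S a)].

End Bundles.

(* Main.v *)
(* A lift of Z_n to a line bundle L0 on T^*C = R^4 and a lift to another bundle E
   of the same curvature are compared through a unitary parallel isomorphism
   L0 -> E, which exists because R^4 is simply connected. On a ball the two
   connection forms in unitary frames e, e' are i alpha and i alpha' with
   d alpha = d alpha', so alpha - alpha' = d phi by the Poincare lemma and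
   e |-> exp (i phi) e' is parallel. Two parallel isomorphisms over a convex set
   differ by a constant, so that these local isomorphisms can be glued along the
   segment from 0 to any point x, and, once normalized at 0, glued globally.
   Being parallel, the isomorphism commutes with the two lifts of g^k up to a
   constant c_k of modulus 1; k |-> c_k is a character of Z_n, hence one of the
   chi_a, and twisting by F_a is the only freedom. The twists by distinct a are
   inequivalent since automorphisms of L0 are constants. A prequantum bundle
   exists: the trivial one in the symmetric (rotation invariant) gauge. *)

(* Smoothness means iterated derivatives along constant directions, so linearity in the direction,
   symmetry of mixed derivatives and continuity of a primitive must all be drawn from the mean value
   theorem on segments.

   The ratio of two parallel maps is shown to be constant over convex sets only. This dictates the
   continuation along the segment from 0 to x: a supremum argument on tubes of common radius, whose
   overlaps are convex.

   Fibres over different base points are different types, and [rotation (k + l) x] is only provably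
   equal to [rotation k (rotation l x)]. Constants are therefore compared in the total space, by
   pairing with a unit section defined over the whole base.

   The classification is proved for an arbitrary choice of tensor products L_a. The constant section
   1 of F_a is parallel, of norm 1, and multiplied by chi_a under the lift; hence u -> u (x) 1 is a
   parallel isometry from L_0 to L_a, commuting with the lifts up to chi_a. The count is exact
   because X^n - 1 has at most n roots and the n values exp (2 i pi a / n) are distinct. *)
Require Import Defs.
From HB Require Import structures.
From mathcomp Require Import all_boot all_order all_algebra.
From mathcomp Require Import sesquilinear.
From mathcomp Require Import all_classical all_reals all_analysis.
From mathcomp.real_closed Require Import complex.
From mathcomp Require Import ring lra.

Set Implicit Arguments.
Unset Strict Implicit.
Unset Printing Implicit Defensive.

Import Order.TTheory GRing.Theory Num.Theory.
Import numFieldNormedType.Exports.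

Local Open Scope classical_set_scope.
Local Open Scope complex_scope.
Local Open Scope ring_scope.

(** * Directional derivatives *)

Section Lines.
Variable R : realType.

(** Both difference quotients are the same function of [h], so no chain rule intervenes. Lines,
    translations and rotations are all handled this way. *)
Lemma derivable_affine (V W U : normedModType R) (f : V -> U) (A : W -> V)
    (y w : W) (v : V) : (forall h : R, A (h *: w + y) = h *: v + A y) ->
  derivable (f \o A) y w <-> derivable f (A y) v.
Proof.
move=> Aw; rewrite /derivable.
suff -> : (fun h : R => h^-1 *: (((f \o A) \o shift y) (h *: w) - (f \o A) y)) =
  (fun h : R => h^-1 *: ((f \o shift (A y)) (h *: v) - f (A y))) by [].
by apply/funext => h /=; rewrite Aw.
Qed.

Lemma derive_affine (V W U : normedModType R) (f : V -> U) (A : W -> V)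
    (y w : W) (v : V) : (forall h : R, A (h *: w + y) = h *: v + A y) ->
  'D_w (f \o A) y = 'D_v f (A y).
Proof.
move=> Aw; rewrite /derive.
suff -> : (fun h : R => h^-1 *: (((f \o A) \o shift y) (h *: w) - (f \o A) y)) =
  (fun h : R => h^-1 *: ((f \o shift (A y)) (h *: v) - f (A y))) by [].
by apply/funext => h /=; rewrite Aw.
Qed.

Lemma is_derive_line (V : normedModType R) (f : V -> R) (x v : V) (t : R) :
  derivable f (x + t *: v) v ->
  is_derive t 1 (fun s : R => f (x + s *: v)) ('D_v f (x + t *: v)).
Proof.
move=> df; pose A (s : R) := x + s *: v.
have Av h : A (h *: 1 + t) = h *: v + A t.
  by rewrite /A [_%:A]mulr1 scalerDl addrCA.
by split; [apply/(derivable_affine f Av) | apply: (derive_affine f Av)].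
Qed.

Lemma mvt_derive (f df : R -> R) (a b : R) : a < b ->
  (forall t, a <= t <= b -> is_derive t 1 f (df t)) ->
  exists2 t, a < t < b & f b - f a = df t * (b - a).
Proof.
move=> ab fdf.
have [| |t + ->] := @MVT R f df a b ab.
- by move=> t; rewrite in_itv /= => /andP[/ltW ? /ltW ?]; apply: fdf; apply/andP.
- apply: derivable_within_continuous => t; rewrite in_itv /= => /fdf.
  by case.
- by rewrite in_itv /=; exists t.
Qed.

Lemma mvt_line (V : normedModType R) (f : V -> R) (x v : V) :
  (forall t : R, 0 <= t <= 1 -> derivable f (x + t *: v) v) ->
  exists2 t : R, 0 < t < 1 & f (x + v) - f x = 'D_v f (x + t *: v).
Proof.
move=> df.
have [t t01 E] := @mvt_derive (fun s : R => f (x + s *: v))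
   (fun t => 'D_v f (x + t *: v)) 0 1 ltr01 (fun t Ht => is_derive_line (df t Ht)).
by exists t => //; move: E; rewrite scale1r scale0r addr0 subr0 mulr1.
Qed.

Lemma deriveZ_dir (V U : normedModType R) (f : V -> U) (x v : V) (a : R) :
  derivable f x v ->
  derivable f x (a *: v) /\ 'D_(a *: v) f x = a *: 'D_v f x.
Proof.
have [->|a0] := eqVneq a 0.
  by rewrite !scale0r; split; [exact: derivable0 | exact: derive0].
move=> df.
have H : (fun h : R => h^-1 *: ((f \o shift x) (h *: (a *: v)) - f x)) @ 0^' -->
    a *: 'D_v f x.
  have -> : (fun h : R => h^-1 *: ((f \o shift x) (h *: (a *: v)) - f x)) =
     (fun h : R => a *: ((h * a)^-1 *: ((f \o shift x) ((h * a) *: v) - f x))).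
    apply/funext => h; rewrite !scalerA invfM mulrCA divff //.
    by rewrite mulr1.
  apply: cvgZr.
  have : (fun h : R => h^-1 *: ((f \o shift x) (h *: v) - f x)) @ 0^' --> 'D_v f x.
    exact: df.
  apply: cvg_comp.
  (* Multiplication by [a] sends the punctured ball of radius e / |a| into that of radius [e]. *)
  move=> P /= [e e0 Pe]; exists (e / `|a|) => /=; first by rewrite divr_gt0 ?normr_gt0.
  move=> h /=; rewrite sub0r normrN => he h0; apply: Pe; last by rewrite mulf_neq0.
  by rewrite /= sub0r normrN normrM -ltr_pdivlMr ?normr_gt0.
by split; [apply/cvg_ex; exists (a *: 'D_v f x) | apply: cvg_lim].
Qed.

End Lines.

Lemma dist_half_le (R : realType) (p q s e : R) :
  `|p - q| < e / 2 -> `|s - q| < e / 2 -> `|p - s| <= e.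
Proof. by rewrite !ltr_norml ler_norml => /andP[? ?] /andP[? ?]; lra. Qed.

(** * Linearity in the direction, symmetry of second derivatives, convex sets *)

Section SecondOrder.
Variables (R : realType) (V : normedModType R).
Implicit Types (f : V -> R) (U : set V) (x u v w : V).

Lemma nbhs_norm_lt x (P : set V) : nbhs x P ->
  exists2 r : R, 0 < r & forall w, `|w| < r -> P (x + w).
Proof.
move=> /nbhs_ballP[r /= r0 rP]; exists r => // w wr; apply: rP.
by rewrite -ball_normE /ball_ /= opprD addrA subrr add0r normrN.
Qed.

(** The summand 1 keeps the factor positive when [u] and [v] vanish, so that radii can be divided by
    it. *)
Lemma norm_scale_lt (h r t : R) u v : 0 <= t <= 1 ->
  `|h| * (`|u| + `|v| + 1) < r -> `|h *: v + t *: (h *: u)| < r.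
Proof.
move=> /andP[t0 t1] hr; apply: le_lt_trans hr.
apply: le_trans (ler_normD _ _) _; rewrite !normrZ.
have -> : `|h| * (`|u| + `|v| + 1) = `|h| * `|v| + `|h| * `|u| + `|h| by ring.
rewrite (ger0_norm t0) -addrA; apply: lerD => //; apply: ler_wpDr => //.
by apply: ler_piMl => //; apply: mulr_ge0.
Qed.

(** Directional derivatives alone need not be additive in the direction. The increment along [u + v]
    is an increment along [v] at [x] plus one along [u] at [x + h *: v]; by the mean value theorem
    the latter is [h] times ['D_u f] at a nearby point, and continuity of ['D_u f] concludes. *)
Lemma derive_add_dir f U x u v : open U -> U x ->
  (forall y, U y -> forall w, derivable f y w) ->
  {for x, continuous ('D_u f)} ->
  'D_(u + v) f x = 'D_u f x + 'D_v f x.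
Proof.
move=> oU Ux df cu; apply: cvg_lim => //.
have -> : (fun h : R => h^-1 *: ((f \o shift x) (h *: (u + v)) - f x)) =
  (fun h : R => h^-1 *: (f (x + h *: v + h *: u) - f (x + h *: v)) +
                h^-1 *: ((f \o shift x) (h *: v) - f x)).
  apply/funext => h /=; rewrite -scalerDr; congr (_ *: _).
  rewrite (addrC (h *: v) x) addrA subrK; congr (f _ - _).
  by rewrite scalerDr addrC addrA addrAC.
apply: cvgD; last exact: df.
apply/cvgrPdist_lt => e e0.
have [r r0 rU] := nbhs_norm_lt (open_nbhs_nbhs (conj oU Ux)).
have [d d0 dc] := nbhs_norm_lt ((cvgrPdist_lt _ _).1 cu _ e0).
have M0 : 0 < `|u| + `|v| + 1 by rewrite ltr_pwDr // addr_ge0.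
exists (Num.min r d / (`|u| + `|v| + 1)) => /=; first by rewrite divr_gt0 // lt_min r0.
move=> h /=; rewrite sub0r normrN ltr_pdivlMr // lt_min => /andP[hr hd] h0.
have [|t /andP[t0 t1] ->] := @mvt_line R V f (x + h *: v) (h *: u).
  by move=> t t01; rewrite -addrA; apply: df; apply: rU; exact: norm_scale_lt.
have tt : 0 <= t <= 1 by rewrite !ltW.
rewrite -addrA.
have [_ ->] := deriveZ_dir h (df _ (rU _ (norm_scale_lt tt hr)) u).
rewrite [h^-1 *: _]scalerA mulVf // scale1r.
exact: (dc _ (norm_scale_lt tt hd)).
Qed.

Lemma derive_linear_dir f U x u v (a : R) : open U -> U x ->
  (forall y, U y -> forall w, derivable f y w) ->
  (forall w, {for x, continuous ('D_w f)}) ->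
  'D_(a *: u + v) f x = a * 'D_u f x + 'D_v f x.
Proof.
move=> oU Ux df cf; rewrite (derive_add_dir v oU Ux df (cf _)).
by have [_ ->] := deriveZ_dir a (df _ Ux u).
Qed.

Lemma derive_shift_dir f x w u : 'D_u (fun y => f (y + w)) x = 'D_u f (x + w).
Proof.
apply: (@derive_affine R _ _ _ f (fun y => y + w)) => h; exact: esym (addrA _ _ _).
Qed.

Lemma derivable_shift_dir f x w u :
  derivable (fun y => f (y + w)) x u <-> derivable f (x + w) u.
Proof.
apply: (@derivable_affine R _ _ _ f (fun y => y + w)) => h; exact: esym (addrA _ _ _).
Qed.

(** The mean value theorem is applied twice: along [u] to the difference of [f] and its translate by
    [h *: v], then along [v] to ['D_u f]. *)
Lemma second_difference f x u v (r h : R) :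
  (forall w, `|w| < r -> forall z, derivable f (x + w) z) ->
  (forall w, `|w| < r -> forall z, derivable ('D_u f) (x + w) z) ->
  `|h| * (`|u| + `|v| + 1) < r ->
  exists2 w, `|w| <= `|h| * (`|u| + `|v| + 1) &
    f (x + h *: u + h *: v) - f (x + h *: u) - (f (x + h *: v) - f x) =
    h ^+ 2 * 'D_v ('D_u f) (x + w).
Proof.
move=> df ddf hr; pose g := (fun y => f (y + h *: v)) - f.
have small s t : 0 <= s <= 1 -> 0 <= t <= 1 ->
   `|s *: (h *: u) + t *: (h *: v)| <= `|h| * (`|u| + `|v| + 1).
  move=> /andP[s0 s1] /andP[t0 t1]; apply: le_trans (ler_normD _ _) _.
  rewrite !normrZ (ger0_norm s0) (ger0_norm t0) !mulrDr mulr1.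
  have := mulr_ge0 (normr_ge0 h) (normr_ge0 u).
  have := mulr_ge0 (normr_ge0 h) (normr_ge0 v).
  have := normr_ge0 h.
  set p := `|h| * `|u|; set q := `|h| * `|v|; nra.
have i01 (t : R) : 0 < t < 1 -> 0 <= t <= 1 by case/andP => /ltW -> /ltW ->.
have dfs s t z : 0 <= s <= 1 -> 0 <= t <= 1 ->
  derivable f (x + s *: (h *: u) + t *: (h *: v)) z.
  by move=> hs ht; rewrite -addrA; apply: df; apply: le_lt_trans (small _ _ hs ht) hr.
have t0 : 0 <= (0 : R) <= 1 by rewrite lexx ler01.
have t1 : 0 <= (1 : R) <= 1 by rewrite ler01 lexx.
have dg s z : 0 <= s <= 1 -> derivable (fun y => f (y + h *: v)) (x + s *: (h *: u)) z
   /\ derivable f (x + s *: (h *: u)) z.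
  move=> hs; split; last by have := dfs s 0 z hs t0; rewrite scale0r addr0.
  by apply/derivable_shift_dir; have := dfs s 1 z hs t1; rewrite scale1r.
have [|s /i01 hs E] := @mvt_line R V g x (h *: u).
  by move=> s hs; have [] := dg s (h *: u) hs; exact: derivableB.
have [d1 d2] := dg s u hs.
have -> : f (x + h *: u + h *: v) - f (x + h *: u) - (f (x + h *: v) - f x) =
   g (x + h *: u) - g x by [].
rewrite E.
have [_ ->] : derivable g (x + s *: (h *: u)) (h *: u) /\
   'D_(h *: u) g (x + s *: (h *: u)) = h *: 'D_u g (x + s *: (h *: u)).
  by apply: deriveZ_dir; exact: (derivableB d1 d2).
rewrite (deriveB d1 d2) derive_shift_dir.
have [|t /i01 ht ->] := @mvt_line R V ('D_u f) (x + s *: (h *: u)) (h *: v).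
  move=> t ht; rewrite -addrA; apply: ddf; exact: le_lt_trans (small _ _ hs ht) hr.
exists (s *: (h *: u) + t *: (h *: v)); first exact: small.
rewrite -addrA.
have dd := ddf _ (le_lt_trans (small _ _ hs ht) hr) v.
have [_ ->] := deriveZ_dir h dd.
by rewrite expr2 -mulrA.
Qed.

(** The second difference is symmetric in [u] and [v], so the two mixed derivatives take a common
    value at two points close to [x]; continuity brings both back to [x]. *)
Lemma schwarz f U x u v : open U -> U x ->
  (forall y, U y -> forall z, derivable f y z) ->
  (forall y, U y -> forall w z, derivable ('D_w f) y z) ->
  {for x, continuous ('D_u ('D_v f))} -> {for x, continuous ('D_v ('D_u f))} ->
  'D_u ('D_v f) x = 'D_v ('D_u f) x.
Proof.
move=> oU Ux df ddf c1 c2; apply/eqP; rewrite -subr_eq0 -normr_le0.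
apply/ler_addgt0Pr => e e0; rewrite add0r.
have [r r0 rU] := nbhs_norm_lt (open_nbhs_nbhs (conj oU Ux)).
have e20 : 0 < e / 2 by rewrite divr_gt0.
have [d1 d10 dc1] := nbhs_norm_lt ((cvgrPdist_lt _ _).1 c1 _ e20).
have [d2 d20 dc2] := nbhs_norm_lt ((cvgrPdist_lt _ _).1 c2 _ e20).
have M0 : 0 < `|u| + `|v| + 1 by rewrite ltr_pwDr // addr_ge0.
pose m := Num.min r (Num.min d1 d2).
have m0 : 0 < m by rewrite !lt_min r0 d10.
(* Half of the admissible size: the displacements, bounded by |h| (|u| + |v| + 1) = m / 2, stay
   strictly below [m]. *)
pose h := m / (`|u| + `|v| + 1) / 2.
have h0 : 0 < h by rewrite !divr_gt0.
have hM : `|h| * (`|u| + `|v| + 1) < m.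
  rewrite gtr0_norm // /h mulrAC divfK ?gt_eqF // ltr_pdivrMr // ltr_pMr // .
  by rewrite ltr1n.
have hM' : `|h| * (`|v| + `|u| + 1) < m by rewrite (addrC `|v|).
have mr : m <= r by rewrite ge_min lexx.
have [w1 w1h E1] := @second_difference f x u v r h (fun w wr => df _ (rU _ wr))
  (fun w wr => ddf _ (rU _ wr) _) (lt_le_trans hM mr).
have [w2 w2h E2] := @second_difference f x v u r h (fun w wr => df _ (rU _ wr))
  (fun w wr => ddf _ (rU _ wr) _) (lt_le_trans hM' mr).
have hh : h ^+ 2 != 0 by rewrite expf_neq0 // gt_eqF.
have E : 'D_v ('D_u f) (x + w1) = 'D_u ('D_v f) (x + w2).
  move: E1 E2; rewrite (addrAC x (h *: v)).
  move: ('D_u _ _) ('D_v _ _) => p q E1 E2; apply: (mulfI hh); rewrite -E1 -E2.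
  by move: (f _) (f _) (f _) (f _) => ????; ring.
have A1 : `|'D_u ('D_v f) x - 'D_u ('D_v f) (x + w2)| < e / 2.
  apply: (dc1 w2); apply: le_lt_trans w2h _; apply: lt_le_trans hM' _.
  by rewrite !ge_min lexx /= orbT.
have A2 : `|'D_v ('D_u f) x - 'D_v ('D_u f) (x + w1)| < e / 2.
  apply: (dc2 w1); apply: le_lt_trans w1h _; apply: lt_le_trans hM _.
  by rewrite !ge_min lexx !orbT.
by rewrite E in A2; exact: dist_half_le A1 A2.
Qed.

Definition convex_subset U := forall x y (t : R), U x -> U y ->
  0 <= t <= 1 -> U (x + t *: (y - x)).

Lemma derive0_const f U : convex_subset U ->
  (forall x, U x -> forall v, derivable f x v /\ 'D_v f x = 0) ->
  forall x y, U x -> U y -> f x = f y.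
Proof.
move=> cU df x y Ux Uy.
have [|t /andP[t0 t1] ] := @mvt_line R V f x (y - x).
  by move=> t t01; have [] := df _ (cU x y t Ux Uy t01) (y - x).
have t01 : 0 <= t <= 1 by rewrite !ltW.
have [_ ->] := df _ (cU x y t Ux Uy t01) (y - x).
by rewrite (addrC x (y - x)) subrK => /eqP; rewrite subr_eq0 => /eqP.
Qed.

Lemma convex_ball x (r : R) : convex_subset (ball x r).
Proof.
move=> y z t; rewrite -ball_normE /ball_ /= => yr zr /andP[t0 t1].
have -> : x - (y + t *: (z - y)) = (1 - t) *: (x - y) + t *: (x - z).
  have E : x - z - (x - y) = - (z - y) by rewrite opprB addrC addrA subrK opprB.
  by rewrite scalerBl scale1r -addrA (addrC (- _)) -scalerBr E scalerN opprD addrA.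
apply: le_lt_trans (ler_normD _ _) _; rewrite !normrZ (ger0_norm t0).
rewrite ger0_norm ?subr_ge0 //.
have M : Num.max `|x - y| `|x - z| < r by rewrite gt_max yr.
apply: le_lt_trans M; set m := Num.max _ _.
have my : `|x - y| <= m by rewrite le_max lexx.
have mz : `|x - z| <= m by rewrite le_max lexx orbT.
have E : m = (1 - t) * m + t * m by rewrite -mulrDl subrK mul1r.
by rewrite E lerD // ler_wpM2l // subr_ge0.
Qed.

Lemma convex_subsetI U W : convex_subset U -> convex_subset W -> convex_subset (U `&` W).
Proof. by move=> cU cW x y t [Ux Wx] [Uy Wy] t01; split; [exact: cU | exact: cW]. Qed.

End SecondOrder.

(** * Smooth functions on the phase space *)

Section Germs.
Variables (R : realType) (V : normedModType R).
Implicit Types (f g : V -> R) (U : set V) (x v : V).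

Lemma near_open U x (P : V -> Prop) : open U -> U x -> (forall y, U y -> P y) ->
  \forall y \near x, P y.
Proof. by move=> oU Ux UP; apply: filterS UP _; exact: open_nbhs_nbhs. Qed.

Lemma eq_derive_open U f g x v : open U -> U x -> (forall y, U y -> f y = g y) ->
  'D_v f x = 'D_v g x.
Proof. by move=> oU Ux fg; apply: near_eq_derive; exact: near_open Ux fg. Qed.

Lemma eq_derivable_open U f g x v : open U -> U x -> (forall y, U y -> f y = g y) ->
  derivable f x v -> derivable g x v.
Proof. by move=> oU Ux fg; apply: near_eq_derivable; exact: near_open Ux fg. Qed.

Lemma eq_continuous_open U f g x : open U -> U x -> (forall y, U y -> f y = g y) ->
  {for x, continuous f} -> {for x, continuous g}.
Proof.
move=> oU Ux fg cf.
suff : g @ x --> f x by rewrite (fg _ Ux).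
have {}cf : f @ x --> f x by [].
apply: cvg_trans cf; apply: near_eq_cvg.
exact: (@near_open U x (fun y => f y = g y)).
Qed.

End Germs.

Section Smooth.
Variable R : realType.
Local Notation V := (phase R).
Implicit Types (f g : V -> R) (U W : set V) (x u v : V).

(** Finite-order smoothness, made for induction on the order: the product rule and the derivatives
    of cos and sin bring back the original functions, which are available at the lower order by
    [CnW]. *)
Fixpoint Cn (n : nat) U f : Prop :=
  (forall x, U x -> {for x, continuous f} /\ forall v, derivable f x v) /\
  match n with
  | 0 => True
  | n'.+1 => forall v, Cn n' U ('D_v f)
  end.

Lemma Cn0 n U f : Cn n U f ->
  forall x, U x -> {for x, continuous f} /\ forall v, derivable f x v.
Proof. by case: n => [|n] []. Qed.

Lemma CnW n U f : Cn n.+1 U f -> Cn n U f.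
Proof.
elim: n f => [|n IH] f [C0 CS]; split => //.
by move=> v; apply: IH; exact: CS.
Qed.

(** [foldr] differentiates along the last vector of the list first, so both directions work at the
    right end of the list. *)
Lemma smooth_onP U f : smooth_on U f <-> forall n, Cn n U f.
Proof.
split=> [sf n | Cf vs x Ux] /=.
  elim: n f sf => [|n IH] f sf; split => //; try exact: (sf [::]).
  by move=> v; apply: IH => vs; have := sf (rcons vs v); rewrite foldr_rcons.
suff : Cn 0 U (foldr (fun v h => 'D_v h) f vs) by case=> /(_ x Ux).
have := Cf (size vs); elim/last_ind: vs f {Cf} => [|vs v IH] f //.
by rewrite size_rcons foldr_rcons => -[_ /(_ v)]; exact: IH.
Qed.

Lemma Cn_ext n U f g : open U -> (forall x, U x -> f x = g x) -> Cn n U f -> Cn n U g.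
Proof.
move=> oU; elim: n f g => [|n IH] f g fg [C0 CS].
  split; last by [].
  move=> x Ux; have [cf df] := C0 x Ux; split.
    exact: (eq_continuous_open oU Ux fg cf).
  by move=> v; exact: (eq_derivable_open oU Ux fg (df v)).
split.
  move=> x Ux; have [cf df] := C0 x Ux; split.
    exact: (eq_continuous_open oU Ux fg cf).
  by move=> v; exact: (eq_derivable_open oU Ux fg (df v)).
move=> v; apply: (IH ('D_v f) ('D_v g) _ (CS v)) => x Ux.
exact: (eq_derive_open v oU Ux fg).
Qed.

Lemma Cn_cst n U (a : R) : Cn n U (cst a).
Proof.
elim: n a => [|n IH] a; split=> //.
- by move=> x _; split; [exact: cst_continuous | move=> v; exact: derivable_cst].
- by move=> x _; split; [exact: cst_continuous | move=> v; exact: derivable_cst].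
- move=> v; have -> : 'D_v (cst a : V -> R) = cst 0; last exact: IH.
  by apply/funext => x; rewrite derive_cst.
Qed.

Lemma CnD n U f g : open U -> Cn n U f -> Cn n U g -> Cn n U (f + g).
Proof.
move=> oU; elim: n f g => [|n IH] f g [f0 fS] [g0 gS].
  split; last by [].
  move=> x Ux; have [cf df] := f0 x Ux; have [cg dg] := g0 x Ux.
  split; first exact: continuousD.
  by move=> v; exact: (derivableD (df v) (dg v)).
split.
  move=> x Ux; have [cf df] := f0 x Ux; have [cg dg] := g0 x Ux.
  split; first exact: continuousD.
  by move=> v; exact: (derivableD (df v) (dg v)).
move=> v; apply: (Cn_ext oU _ (IH _ _ (fS v) (gS v))) => x Ux.
by rewrite (deriveD ((f0 x Ux).2 v) ((g0 x Ux).2 v)).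
Qed.

Lemma CnM n U f g : open U -> Cn n U f -> Cn n U g -> Cn n U (f * g).
Proof.
move=> oU; elim: n f g => [|n IH] f g.
  move=> [f0 fS] [g0 gS].
  split; last by [].
  move=> x Ux; have [cf df] := f0 x Ux; have [cg dg] := g0 x Ux.
  split; first exact: continuousM.
  by move=> v; exact: (derivableM (df v) (dg v)).
move=> Cf Cg; have [f0 fS] := Cf; have [g0 gS] := Cg.
split.
  move=> x Ux; have [cf df] := f0 x Ux; have [cg dg] := g0 x Ux.
  split; first exact: continuousM.
  by move=> v; exact: (derivableM (df v) (dg v)).
move=> v.
apply: (Cn_ext oU _ (CnD oU (IH _ _ (CnW Cf) (gS v)) (IH _ _ (CnW Cg) (fS v)))) => x Ux.
by rewrite (deriveM ((f0 x Ux).2 v) ((g0 x Ux).2 v)).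
Qed.

Lemma smooth_on_sub U W f : W `<=` U -> smooth_on U f -> smooth_on W f.
Proof. by move=> WU sf vs x /WU; exact: sf. Qed.

Lemma smooth_on_local U f :
  (forall x, U x -> exists2 W, W x & smooth_on W f) -> smooth_on U f.
Proof. by move=> loc vs x /loc[W Wx /(_ vs x Wx)]. Qed.

Lemma smooth_on_ext U f g : open U -> (forall x, U x -> f x = g x) ->
  smooth_on U f -> smooth_on U g.
Proof. by move=> oU fg /smooth_onP Cf; apply/smooth_onP => n; exact: (Cn_ext oU fg (Cf n)). Qed.

Lemma smooth_on_continuous U f x : smooth_on U f -> U x -> {for x, continuous f}.
Proof. by move=> sf Ux; have [] := sf [::] x Ux. Qed.

Lemma smooth_on_derivable U f x v : smooth_on U f -> U x -> derivable f x v.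
Proof. by move=> sf Ux; have [_] := sf [::] x Ux; apply. Qed.

Lemma smooth_on_derive U f v : smooth_on U f -> smooth_on U ('D_v f).
Proof. by move=> sf vs; have := sf (rcons vs v); rewrite foldr_rcons. Qed.

Lemma smooth_on_intro U f :
  (forall x, U x -> {for x, continuous f} /\ forall v, derivable f x v) ->
  (forall v, smooth_on U ('D_v f)) -> smooth_on U f.
Proof.
move=> f0 fS; apply/smooth_onP => -[|n]; split => // v.
exact: (smooth_onP _ _).1 n.
Qed.

Lemma smooth_on_cst U (a : R) : smooth_on U (fun _ => a).
Proof. by apply/smooth_onP => n; exact: Cn_cst. Qed.

Lemma smooth_onD U f g : open U -> smooth_on U f -> smooth_on U g ->
  smooth_on U (fun x => f x + g x).
Proof.
by move=> oU /smooth_onP sf /smooth_onP sg; apply/smooth_onP => n; exact: CnD.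
Qed.

Lemma smooth_onM U f g : open U -> smooth_on U f -> smooth_on U g ->
  smooth_on U (fun x => f x * g x).
Proof.
by move=> oU /smooth_onP sf /smooth_onP sg; apply/smooth_onP => n; exact: CnM.
Qed.

Lemma smooth_onN U f : open U -> smooth_on U f -> smooth_on U (fun x => - f x).
Proof.
move=> oU sf; apply: (smooth_on_ext oU _ (smooth_onM oU (@smooth_on_cst U (-1)) sf)) => x _.
by rewrite mulN1r.
Qed.

Lemma smooth_onB U f g : open U -> smooth_on U f -> smooth_on U g ->
  smooth_on U (fun x => f x - g x).
Proof. by move=> oU sf sg; exact: (smooth_onD oU sf (smooth_onN oU sg)). Qed.

Lemma derive_smooth_linear U f x u v (a : R) : open U -> U x -> smooth_on U f ->
  'D_(a *: u + v) f x = a * 'D_u f x + 'D_v f x.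
Proof.
move=> oU Ux sf; apply: (@derive_linear_dir _ _ f U) => //.
  by move=> y Uy w; exact: smooth_on_derivable Uy.
by move=> w; apply: smooth_on_continuous Ux; exact: smooth_on_derive.
Qed.

Lemma derive_smooth_comm U f x u v : open U -> U x -> smooth_on U f ->
  'D_u ('D_v f) x = 'D_v ('D_u f) x.
Proof.
move=> oU Ux sf; apply: (@schwarz _ _ f U) => //.
- by move=> y Uy w; exact: smooth_on_derivable Uy.
- by move=> y Uy w z; apply: smooth_on_derivable Uy; exact: smooth_on_derive.
- by apply: smooth_on_continuous Ux; do 2 apply: smooth_on_derive.
- by apply: smooth_on_continuous Ux; do 2 apply: smooth_on_derive.
Qed.

Lemma derive_coord (i : 'I_4) x v : 'D_v (fun y : V => y 0 i) x = v 0 i.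
Proof.
have := @derive_mx R V 1 4 id x v (@derivable_id R V x v); rewrite derive_id => /matrixP/(_ 0 i).
by rewrite mxE.
Qed.

Lemma smooth_on_coord U (i : 'I_4) : smooth_on U (fun x : V => x 0 i).
Proof.
apply: smooth_on_intro.
  move=> x _; split; first exact: coord_continuous.
  by move=> v; apply: diff_derivable; exact: differentiable_coord.
move=> v; have -> : 'D_v (fun x : V => x 0 i) = fun _ => v 0 i.
  by apply/funext => x; rewrite derive_coord.
exact: smooth_on_cst.
Qed.

(** On the line t -> x + t v this is the chain rule in one variable. *)
Lemma derive_comp1 (h : R -> R) (f : V -> R) x v d :
  derivable f x v -> is_derive (f x) 1 h d ->
  derivable (h \o f) x v /\ 'D_v (h \o f) x = d * 'D_v f x.
Proof.
move=> df dh.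
pose A (t : R) := x + t *: v.
have Av : forall k : R, A (k *: 1 + 0) = k *: v + A 0.
  by move=> k; rewrite /A [_%:A]mulr1 scale0r !addr0 addrC.
have A0 : A 0 = x by rewrite /A scale0r addr0.
have dA : is_derive (0 : R) 1 (f \o A) ('D_v f x).
  split; first by apply/(derivable_affine f Av); rewrite A0.
  by rewrite (derive_affine f Av) A0.
have dh' : is_derive ((f \o A) 0) 1 h d by rewrite /= A0.
have [d1 d2] := is_derive1_comp dh' dA.
have dd : derivable (h \o f) x v.
  by have := (derivable_affine (h \o f) Av).1 d1; rewrite A0.
split=> //; rewrite -d2.
by rewrite -[in LHS]A0 -(derive_affine (h \o f) Av).
Qed.

Lemma CnN n U f : open U -> Cn n U f -> Cn n U (- f).
Proof.
move=> oU Cf; apply: (Cn_ext oU _ (CnM oU (@Cn_cst n U (-1)) Cf)) => x _.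
by rewrite -[LHS]/(-1 * f x) mulN1r.
Qed.

(** The two claims are proved together, since each derivative involves the other function. *)
Lemma Cn_cos_sin n U f : open U -> Cn n U f ->
  Cn n U (fun x => cos (f x)) /\ Cn n U (fun x => sin (f x)).
Proof.
move=> oU; elim: n f => [|n IH] f Cf.
  have C0 := Cn0 Cf.
  split; (split; last by []) => x Ux; have [cf df] := C0 x Ux.
    split; first by apply: continuous_comp cf _; exact: continuous_cos.
    by move=> v; have [] := derive_comp1 (df v) (is_derive_cos (f x)).
  split; first by apply: continuous_comp cf _; exact: continuous_sin.
  by move=> v; have [] := derive_comp1 (df v) (is_derive_sin (f x)).
have C0 := Cn0 Cf; have [Cc Cs] := IH f (CnW Cf).
have [_ CS] := Cf.
split; split.
- move=> x Ux; have [cf df] := C0 x Ux.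
  split; first by apply: continuous_comp cf _; exact: continuous_cos.
  by move=> v; have [] := derive_comp1 (df v) (is_derive_cos (f x)).
- move=> v; apply: (Cn_ext oU _ (CnM oU (CnN oU Cs) (CS v))) => x Ux.
  by have [_ ->] := derive_comp1 ((C0 x Ux).2 v) (is_derive_cos (f x)).
- move=> x Ux; have [cf df] := C0 x Ux.
  split; first by apply: continuous_comp cf _; exact: continuous_sin.
  by move=> v; have [] := derive_comp1 (df v) (is_derive_sin (f x)).
- move=> v; apply: (Cn_ext oU _ (CnM oU Cc (CS v))) => x Ux.
  by have [_ ->] := derive_comp1 ((C0 x Ux).2 v) (is_derive_sin (f x)).
Qed.

Lemma smooth_on_cos U f : open U -> smooth_on U f -> smooth_on U (fun x => cos (f x)).
Proof.
by move=> oU /smooth_onP Cf; apply/smooth_onP => n; have [] := Cn_cos_sin oU (Cf n).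
Qed.

Lemma smooth_on_sin U f : open U -> smooth_on U f -> smooth_on U (fun x => sin (f x)).
Proof.
by move=> oU /smooth_onP Cf; apply/smooth_onP => n; have [] := Cn_cos_sin oU (Cf n).
Qed.

Lemma smooth_on_comp_linear U f (A : V -> V) :
  (forall (h : R) x y, A (h *: x + y) = h *: A x + A y) -> continuous A ->
  smooth_on U f -> smooth_on (A @^-1` U) (f \o A).
Proof.
move=> lA cA /smooth_onP Cf; apply/smooth_onP => n.
have {Cf} := Cf n; elim: n f => [|n IH] f [f0 fS].
  split; last by []; move=> x Ux; have [cf df] := f0 _ Ux.
  split; first by apply: continuous_comp cf; exact: cA.
  by move=> v; apply/(@derivable_affine _ _ _ _ f A _ _ (A v)) => // h; exact: lA.
split.
  move=> x Ux; have [cf df] := f0 _ Ux.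
  split; first by apply: continuous_comp cf; exact: cA.
  by move=> v; apply/(@derivable_affine _ _ _ _ f A _ _ (A v)) => // h; exact: lA.
move=> v; have -> : 'D_v (f \o A) = 'D_(A v) f \o A.
  by apply/funext => x; apply: derive_affine => h; exact: lA.
exact: (IH _ (fS (A v))).
Qed.

End Smooth.

(** * The Poincare lemma *)

Section Antiderivative.
Variable R : realType.

Lemma antiderivative (g : R -> R) : continuous g ->
  exists G : R -> R, forall t : R, 0 <= t <= 1 -> is_derive t 1 G (g t).
Proof.
move=> cg.
(* Integration from -1, inside [-1, 2], makes every t of [0, 1], endpoints included, an interior
   point, where the derivative is two-sided. *)
exists (fun x => \int[lebesgue_measure]_(t in [set` `[-1, x]]) g t)%R => t /andP[t0 t1].
have [||||d1 d2] := @continuous_FTC1_closed R g (-1) t 2.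
- by apply: le_lt_trans t1 _; rewrite ltr1n.
- apply: continuous_compact_integrable; first exact: segment_compact.
  exact: continuous_subspaceT.
- by apply: lt_le_trans t0; rewrite ltrN10.
- exact: cg.
by split; [exact: d1 | rewrite -derive1E d2].
Qed.

(** Composing with the retraction [cl] of the line onto [0, 1] yields a function that is continuous
    everywhere and unchanged on the segment. *)
Lemma antiderivative_segment (g : R -> R) :
  (forall t, 0 <= t <= 1 -> {for t, continuous g}) ->
  exists G : R -> R, forall t : R, 0 <= t <= 1 -> is_derive t 1 G (g t).
Proof.
move=> cg; pose cl (t : R) := Num.max 0 (Num.min 1 t).
have clcl t : 0 <= cl t <= 1.
  by rewrite /cl le_max lexx /= ge_max ler01 ge_min lexx.
have clE t : 0 <= t <= 1 -> cl t = t.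
  by case/andP => t0 t1; rewrite /cl (min_idPr t1) (max_idPr t0).
have cc : continuous cl.
  move=> t; apply: continuous_max; first exact: cst_continuous.
  by apply: continuous_min; [exact: cst_continuous | exact: cvg_id].
have [|G HG] := @antiderivative (g \o cl).
  by move=> t; apply: continuous_comp; [exact: cc | exact: cg].
by exists G => t t01; have := HG t t01; rewrite /= clE.
Qed.

End Antiderivative.

(** The arithmetic that ends [closed_form_exact]. [B1] and [B2] are the values of the form on
    [x - c] before and after the displacement by [t *: (h *: u)], [B3] and [B4] those on [u]; [D]
    and [D'] are derivatives at the start and at an intermediate point. *)
Lemma increment_bound (R : realFieldType) (h t e B1 B2 B3 B4 D D' : R) :
  h != 0 -> 0 <= t <= 1 -> `|B4 - B3| < e / 2 -> `|D' - D| < e / 2 ->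
  B2 - B1 = t * h * D' -> `|h^-1 * (h * B4 + B2 - B1) - (t * D + B3)| < e.
Proof.
move=> h0 /andP[t0 t1] H1 H2 E.
have -> : h^-1 * (h * B4 + B2 - B1) - (t * D + B3) = (B4 - B3) + t * (D' - D).
  by rewrite -addrA E; field.
apply: le_lt_trans (ler_normD _ _) _; rewrite (splitr e) ltr_leD // normrM ger0_norm //.
by apply: le_trans (ltW H2); apply: ler_piMl.
Qed.

Section Poincare.
Variables (R : realType) (V : normedModType R).
Implicit Types (U K : set V) (x u v : V).

(** A Heine-Cantor statement in which [y + z] may leave [K], as the perturbed segments do. Around
    each point of [K] half of the radius is kept for [y] and half for [z]. *)
Lemma uniform_on_compact K U (G : V -> R) (e : R) : compact K -> K `<=` U -> open U ->
  (forall x, U x -> {for x, continuous G}) -> 0 < e ->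
  exists2 d : R, 0 < d & forall y z, K y -> `|z| < d ->
    U (y + z) /\ `|G (y + z) - G y| < e.
Proof.
move=> cK KU oU cG e0.
have [_ /nbhs_norm_lt[d d0 H]] : True /\ \forall z \near (0 : V),
    K `<=` (fun y => U (y + z) /\ `|G (y + z) - G y| < e).
  split => //.
  apply: ((compact_near_coveringP K).1 cK V (nbhs (0 : V))
    (fun z y => U (y + z) /\ `|G (y + z) - G y| < e)) => x Kx.
  have Ux := KU _ Kx.
  have [r r0 rU] := nbhs_norm_lt (open_nbhs_nbhs (conj oU Ux)).
  have e20 : 0 < e / 2 by rewrite divr_gt0.
  have [s s0 sG] := nbhs_norm_lt ((cvgrPdist_lt _ _).1 (cG x Ux) _ e20).
  pose m := Num.min r s / 2.
  have m0 : 0 < m by rewrite divr_gt0 // lt_min r0.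
  exists (ball x m, ball 0 m).
    by split; exact: nbhsx_ballx.
  move=> [y z] /= []; rewrite -!ball_normE /ball_ /= sub0r normrN distrC => yx zm.
  have yE : y = x + (y - x) by rewrite addrC subrK.
  have yzE : y + z = x + (y - x + z) by rewrite addrA -yE.
  have mm : m + m = Num.min r s by rewrite /m -splitr.
  have w1 : `|y - x + z| < Num.min r s.
    by rewrite -mm; apply: le_lt_trans (ler_normD _ _) _; rewrite ltrD.
  have w2 : `|y - x| < Num.min r s by rewrite -mm ltr_pwDr // ltW.
  have l1 : `|y - x + z| < r by apply: lt_le_trans w1 _; rewrite ge_min lexx.
  have l2 : `|y - x + z| < s by apply: lt_le_trans w1 _; rewrite ge_min lexx orbT.
  have l3 : `|y - x| < s by apply: lt_le_trans w2 _; rewrite ge_min lexx orbT.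
  split; first by rewrite yzE; apply: rU.
  have := sG _ l2; have /= := sG _ l3; rewrite -yzE -yE => A1 A2.
  rewrite (splitr e) -(subrKA (G x)); apply: le_lt_trans (ler_normD _ _) _.
  by rewrite ltrD // distrC.
exists d => // y z Ky zd; have := H z zd; rewrite add0r; exact.
Qed.

Variables (U : set V) (c : V) (b : V -> V -> R).
Hypotheses (oU : open U) (cU : convex_subset U) (Uc : U c).
Hypothesis b_cont : forall v x, U x -> {for x, continuous (b v)}.
Hypothesis b_der : forall v x, U x -> forall u, derivable (b v) x u.
Hypothesis b_der_cont : forall u v x, U x -> {for x, continuous ('D_u (b v))}.
Hypothesis b_lin : forall (a : R) u v x, U x -> b (a *: u + v) x = a * b u x + b v x.
Hypothesis b_closed : forall u v x, U x -> 'D_u (b v) x = 'D_v (b u) x.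

Let bD u v x : U x -> b (u + v) x = b u x + b v x.
Proof. by move=> Ux; have := b_lin 1 u v Ux; rewrite scale1r mul1r. Qed.

Let b0 x : U x -> b 0 x = 0.
Proof. by move=> Ux; apply: (@addIr _ (b 0 x)); rewrite -bD ?add0r. Qed.

Let ray x (t : R) := c + t *: (x - c).

Let ray_in x t : U x -> 0 <= t <= 1 -> U (ray x t).
Proof. by move=> Ux t01; exact: cU. Qed.

Let ray_continuous x : continuous (ray x).
Proof.
move=> t; have : (c + s *: (x - c)) @[s --> t] --> c + t *: (x - c); last by [].
apply: cvgD; first exact: cvg_cst.
exact: scalel_continuous.
Qed.

Lemma ray_primitive : exists P : V -> R -> R, forall x, U x ->
  forall t : R, 0 <= t <= 1 -> is_derive t 1 (P x) (b (x - c) (ray x t)).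
Proof.
have H x : exists P : R -> R, U x ->
    forall t : R, 0 <= t <= 1 -> is_derive t 1 P (b (x - c) (ray x t)).
  have [Ux|nUx] := pselect (U x); last by exists (fun=> 0).
  have [|P HP] := @antiderivative_segment R (fun t => b (x - c) (ray x t)).
    move=> t t01; apply: (@continuous_comp _ _ _ (ray x) (b (x - c))).
      exact: ray_continuous.
    by apply: b_cont; exact: ray_in.
  by exists P.
by have [P HP] := choice H; exists P.
Qed.

(** [phi] integrates the form along the segment from [c] to [x]. By closedness, the derivative of
    the integrand along [u] is the derivative in t of [t * b u (ray x t)], whose increment over
    [0, 1] is [b u x]. The mean value theorem in t replaces differentiation under the integral
    sign. *)
Lemma closed_form_exact : exists phi : V -> R, forall x, U x -> forall u,
  derivable phi x u /\ 'D_u phi x = b u x.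
Proof.
have [P HP] := ray_primitive.
exists (fun x => P x 1 - P x 0) => x Ux u.
suff H : (fun h : R => h^-1 *: (((fun x => P x 1 - P x 0) \o shift x) (h *: u) -
    (P x 1 - P x 0))) @ 0^' --> b u x.
  by split; [apply/cvg_ex; exists (b u x) | apply: cvg_lim].
apply/cvgrPdist_lt => e e0.
pose K := ray x @` `[0, 1].
have cK : compact K.
  apply: continuous_compact; last exact: segment_compact.
  by apply: continuous_subspaceT; exact: ray_continuous.
have KU : K `<=` U by move=> _ [t /= t01 <-]; apply: ray_in; rewrite ?in_itv in t01.
have e20 : 0 < e / 2 by rewrite divr_gt0.
have [d1 d10 H1] := uniform_on_compact cK KU oU (@b_der_cont (x - c) u) e20.
have [d2 d20 H2] := uniform_on_compact cK KU oU (@b_cont u) e20.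
have M0 : 0 < `|u| + 1 by rewrite ltr_pwDr.
exists (Num.min d1 d2 / (`|u| + 1)) => /=; first by rewrite divr_gt0 // lt_min d10.
move=> h /=; rewrite sub0r normrN ltr_pdivlMr // lt_min => /andP[hd1 hd2] h0.
have small (t : R) : 0 <= t <= 1 -> `|t *: (h *: u)| <= `|h| * (`|u| + 1).
  move=> /andP[t0 t1]; rewrite !normrZ (ger0_norm t0) mulrDr mulr1.
  have := mulr_ge0 (normr_ge0 h) (normr_ge0 u); have := normr_ge0 h.
  by set p := `|h| * `|u|; move=> ??; apply: ler_wpDr => //; apply: ler_piMl.
have Kray (t : R) : 0 <= t <= 1 -> K (ray x t) by move=> t01; exists t => //=; rewrite in_itv.
have Uray (t s : R) : 0 <= t <= 1 -> 0 <= s <= 1 -> U (ray x t + s *: (h *: u)).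
  by move=> t01 s01; have [] := H1 _ (s *: (h *: u)) (Kray t t01)
    (le_lt_trans (small _ s01) hd1).
have i1 : 0 <= (1 : R) <= 1 by rewrite ler01 lexx.
have Uxh : U (x + h *: u).
  by have := Uray 1 1 i1 i1; rewrite /ray !scale1r (addrC c) subrK.
have rayE t : ray (x + h *: u) t = ray x t + t *: (h *: u).
  by rewrite /ray (addrAC x) scalerDr addrA.
(* [q 1 - q 0] is the error of the difference quotient of [phi] along [u], and
   [dq], the derivative of [q], tends to 0 with [h] uniformly on [0, 1]. *)
pose q t := h^-1 * (P (x + h *: u) t - P x t) - t * b u (ray x t).
pose dq t := h^-1 * (b (x + h *: u - c) (ray (x + h *: u) t) - b (x - c) (ray x t)) -
  (t * 'D_(x - c) (b u) (ray x t) + b u (ray x t)).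
have Dq (t : R) : 0 <= t <= 1 -> is_derive t 1 q (dq t).
  move=> t01; have D1 := HP _ Uxh t t01; have D2 := HP _ Ux t t01.
  have D3 := is_derive_line (@b_der u _ (ray_in Ux t01) (x - c)).
  have D4 : is_derive t 1 (fun s => s * b u (ray x s))
       (t * 'D_(x - c) (b u) (ray x t) + b u (ray x t)).
    have J := is_deriveM (@is_derive_id R R t 1) D3.
    by apply: (is_derive_eq J); rewrite [_%:A]mulr1.
  exact: (is_deriveB (is_deriveZ h^-1 (is_deriveB D1 D2)) D4).
have [t /andP[/ltW t0 /ltW t1]] := mvt_derive ltr01 Dq.
have t01 : 0 <= t <= 1 by rewrite t0.
rewrite subr0 mulr1 /q mul0r subr0 mul1r.
have -> : ray x 1 = x by rewrite /ray scale1r addrC subrK.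
move=> E; rewrite /=.
have -> : b u x - h^-1 *: (P (h *: u + x) 1 - P (h *: u + x) 0 - (P x 1 - P x 0)) = - dq t.
  rewrite -E -[_ *: _]/(_ * _) (addrC (h *: u)).
  by move: (P _ _) (P _ _) (P _ _) (P _ _) => ????; ring.
rewrite normrN /dq rayE.
have -> : x + h *: u - c = h *: u + (x - c) by rewrite addrAC addrC.
rewrite b_lin; last exact: Uray.
have [|s /andP[/ltW s0 /ltW s1]] :=
    @mvt_line R V (b (x - c)) (ray x t) (t *: (h *: u)).
  move=> s s01; apply: b_der; rewrite scalerA; apply: Uray => //.
  case/andP: s01 => s0 s1; by rewrite mulr_ge0 //= mulr_ile1.
have st01 : 0 <= s * t <= 1 by rewrite mulr_ge0 //= mulr_ile1.
rewrite (scalerA s t).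
have dd := @b_der (x - c) _ (Uray _ _ t01 st01) u.
have [_] := deriveZ_dir (t * h) dd; rewrite -(scalerA t h u) => ->.
(* Here closedness enters: the derivative of [b (x - c)] along [u] becomes that of [b u] along
   [x - c], the quantity that [H1] controls and that occurs in [dq]. *)
rewrite b_closed; last exact: Uray.
have [_] := H1 _ _ (Kray t t01) (le_lt_trans (small _ st01) hd1).
have [_] := H2 _ _ (Kray t t01) (le_lt_trans (small _ t01) hd2).
rewrite -[_ *: 'D__ _ _]/(_ * _).
move=> A1 A2 A3; exact: (increment_bound h0 t01 A1 A2 A3).
Qed.

End Poincare.

(** Derivability in every direction does not give continuity. A derivative bounded by [G y] times
    the norm of the direction does, by the mean value theorem, since [G] is bounded near [x]. *)
Lemma derive_bound_continuous (R : realType) (V : normedModType R) (U : set V)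
    (f G : V -> R) (x : V) : open U -> U x ->
  (forall y, U y -> forall u, derivable f y u) ->
  (forall y, U y -> forall z, `|'D_z f y| <= G y * `|z|) ->
  {for x, continuous G} -> {for x, continuous f}.
Proof.
move=> oU Ux df fG cG; apply/cvgrPdist_lt => e e0.
have [r r0 rU] := nbhs_norm_lt (open_nbhs_nbhs (conj oU Ux)).
have [d d0 dG] := nbhs_norm_lt ((cvgrPdist_lt _ _).1 cG _ ltr01).
have M0 : 0 < `|G x| + 1 by rewrite ltr_pwDr.
apply/nbhs_ballP; exists (Num.min r (Num.min d (e / (`|G x| + 1)))) => /=.
  by rewrite !lt_min r0 d0 divr_gt0.
move=> y; rewrite -ball_normE /ball_ /= distrC !lt_min ltr_pdivlMr //.
move=> /andP[yr /andP[yd ye]].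
have sm (t : R) : 0 <= t <= 1 -> `|t *: (y - x)| <= `|y - x|.
  by case/andP => t0 t1; rewrite normrZ ger0_norm //; exact: ler_piMl.
have [t t01|s /andP[/ltW s0 /ltW s1]] := @mvt_line R V f x (y - x).
  by apply: df; apply: rU; apply: le_lt_trans (sm _ t01) yr.
rewrite (addrC x (y - x)) subrK -normrN opprB => ->.
have s01 : 0 <= s <= 1 by rewrite s0.
apply: le_lt_trans (fG _ (rU _ (le_lt_trans (sm _ s01) yr)) _) _.
apply: le_lt_trans ye; rewrite mulrC; apply: ler_wpM2l => //.
have := dG _ (le_lt_trans (sm _ s01) yd) => /=.
rewrite distrC => /ltW /ler_distlDr h; apply: le_trans h _.
by rewrite lerD2r ler_norm.
Qed.

Lemma continuous_sum_norm (R : realType) (V : normedModType R) (n : nat)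
    (F : 'I_n -> V -> R) (x : V) : (forall i, {for x, continuous (F i)}) ->
  {for x, continuous (fun y => \sum_(i < n) `|F i y|)}.
Proof.
move=> cF; suff H (s : seq 'I_n) :
    \sum_(i <- s) `|F i y| @[y --> x] --> \sum_(i <- s) `|F i x| by exact: H.
elim: s => [|i s IH].
  rewrite big_nil (_ : (fun y => _) = fun=> 0); first exact: cvg_cst.
  by apply/funext => y; rewrite big_nil.
rewrite big_cons (_ : (fun y => _) = fun y => `|F i y| + \sum_(j <- s) `|F j y|).
  by apply: cvgD => //; apply: cvg_norm; exact: cF.
by apply/funext => y; rewrite big_cons.
Qed.

Section PoincareSmooth.
Variable R : realType.
Local Notation V := (phase R).

Lemma mx_entry_norm (z : V) i : `|z 0 i| <= `|z|.
Proof.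
rewrite [leRHS]/Num.Def.normr /= mx_normrE.
by apply: le_trans (le_bigmax _ _ (0, i)).
Qed.

Variables (U : set V) (c : V) (b : V -> V -> R).
Hypotheses (oU : open U) (cU : convex_subset U) (Uc : U c).
Hypothesis b_smooth : forall v, smooth_on U (b v).
Hypothesis b_lin : forall (a : R) u v x, U x -> b (a *: u + v) x = a * b u x + b v x.
Hypothesis b_closed : forall u v x, U x -> 'D_u (b v) x = 'D_v (b u) x.

Let b_sum z x : U x -> b z x = \sum_(i < 4) z 0 i * b (delta_mx 0 i) x.
Proof.
move=> Ux; have b0 : b 0 x = 0.
  have := b_lin 1 0 0 Ux; rewrite scaler0 addr0 mul1r => /eqP.
  by rewrite -subr_eq0 opprD addrA subrr sub0r oppr_eq0 => /eqP.
rewrite [in LHS](row_sum_delta z).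
elim/big_rec2: _ => [|i y w _ <-]; first exact: b0.
exact: b_lin.
Qed.

Let bound y := \sum_(i < 4) `|b (delta_mx 0 i) y|.

Let bound_continuous x : U x -> {for x, continuous bound}.
Proof.
move=> Ux; apply: continuous_sum_norm => i.
exact: (smooth_on_continuous (b_smooth _) Ux).
Qed.

(** The derivatives of the primitive are the smooth functions [b v], so only its own continuity is
    at stake; [bound], the sum of the absolute coefficients of the form, supplies the Lipschitz
    estimate. *)
Lemma poincare : exists2 phi : V -> R, smooth_on U phi &
  forall x, U x -> forall v, 'D_v phi x = b v x.
Proof.
have [phi Hphi] : exists phi : V -> R, forall x, U x -> forall u,
    derivable phi x u /\ 'D_u phi x = b u x.
  apply: (closed_form_exact oU cU Uc _ _ _ b_lin b_closed).
  - by move=> v x Ux; exact: (smooth_on_continuous (b_smooth v) Ux).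
  - by move=> v x Ux u; exact: (@smooth_on_derivable R U (b v) x u (b_smooth v) Ux).
  - move=> u v x Ux.
    exact: (smooth_on_continuous (smooth_on_derive _ (b_smooth v)) Ux).
exists phi; last by move=> x Ux v; have [] := Hphi x Ux v.
apply: smooth_on_intro.
  move=> x Ux; split; last by move=> v; have [] := Hphi x Ux v.
  apply: (@derive_bound_continuous R V U phi bound x oU Ux _ _ (bound_continuous Ux)).
    by move=> y Uy u; have [] := Hphi y Uy u.
  move=> y Uy z; have [_ ->] := Hphi y Uy z; rewrite b_sum // /bound mulr_suml.
  apply: le_trans (ler_norm_sum _ _ _) _; apply: ler_sum => i _.
  by rewrite normrM mulrC; apply: ler_wpM2l => //; exact: mx_entry_norm.
move=> v; apply: (smooth_on_ext oU _ (b_smooth v)) => x Ux.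
by have [_ ->] := Hphi x Ux v.
Qed.

End PoincareSmooth.

(** * Complex-valued functions *)

Section ComplexSmooth.
Variable R : realType.
Local Notation C := R[i].
Local Notation V := (phase R).
Implicit Types (f g : V -> C) (U W : set V) (x u v : V).

Lemma cReM (a b : C) : complex.Re (a * b) =
  complex.Re a * complex.Re b - complex.Im a * complex.Im b.
Proof. by case: a b => [p q] [r s]. Qed.

Lemma cImM (a b : C) : complex.Im (a * b) =
  complex.Re a * complex.Im b + complex.Im a * complex.Re b.
Proof. by case: a b => [p q] [r s]. Qed.

Lemma cReD (a b : C) : complex.Re (a + b) = complex.Re a + complex.Re b.
Proof. by case: a b => [p q] [r s]. Qed.

Lemma cImD (a b : C) : complex.Im (a + b) = complex.Im a + complex.Im b.
Proof. by case: a b => [p q] [r s]. Qed.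

Lemma cRe_conj (a : C) : complex.Re (Num.conj a) = complex.Re a.
Proof. by case: a. Qed.

Lemma cIm_conj (a : C) : complex.Im (Num.conj a) = - complex.Im a.
Proof. by case: a. Qed.

Lemma complex_eqP (a b : C) : complex.Re a = complex.Re b ->
  complex.Im a = complex.Im b -> a = b.
Proof. by case: a b => [p q] [r s] /= -> ->. Qed.

Lemma csmooth_on_ext U f g : open U -> (forall x, U x -> f x = g x) ->
  csmooth_on U f -> csmooth_on U g.
Proof.
move=> oU fg [fr fi]; split.
  by apply: (smooth_on_ext oU _ fr) => x Ux; rewrite fg.
by apply: (smooth_on_ext oU _ fi) => x Ux; rewrite fg.
Qed.

Lemma csmooth_on_sub U W f : W `<=` U -> csmooth_on U f -> csmooth_on W f.
Proof. by move=> WU [fr fi]; split; exact: (smooth_on_sub WU). Qed.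

Lemma csmooth_on_local U f :
  (forall x, U x -> exists2 W, W x & csmooth_on W f) -> csmooth_on U f.
Proof.
by move=> loc; split; apply: smooth_on_local => x /loc[W Wx []]; exists W.
Qed.

Lemma csmooth_on_cst U (a : C) : csmooth_on U (fun=> a).
Proof. by split; exact: smooth_on_cst. Qed.

Lemma csmooth_onD U f g : open U -> csmooth_on U f -> csmooth_on U g ->
  csmooth_on U (fun x => f x + g x).
Proof.
move=> oU [fr fi] [gr gi]; split.
  by apply: (smooth_on_ext oU _ (smooth_onD oU fr gr)) => x _; rewrite cReD.
by apply: (smooth_on_ext oU _ (smooth_onD oU fi gi)) => x _; rewrite cImD.
Qed.

Lemma csmooth_onM U f g : open U -> csmooth_on U f -> csmooth_on U g ->
  csmooth_on U (fun x => f x * g x).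
Proof.
move=> oU [fr fi] [gr gi]; split.
  apply: (smooth_on_ext oU _ (smooth_onB oU (smooth_onM oU fr gr) (smooth_onM oU fi gi))).
  by move=> x _; rewrite cReM.
apply: (smooth_on_ext oU _ (smooth_onD oU (smooth_onM oU fr gi) (smooth_onM oU fi gr))).
by move=> x _; rewrite cImM.
Qed.

Lemma csmooth_on_conj U f : open U -> csmooth_on U f ->
  csmooth_on U (fun x => Num.conj (f x)).
Proof.
move=> oU [fr fi]; split.
  by apply: (smooth_on_ext oU _ fr) => x _; rewrite cRe_conj.
by apply: (smooth_on_ext oU _ (smooth_onN oU fi)) => x _; rewrite cIm_conj.
Qed.

Lemma csmooth_on_cderive U f v : csmooth_on U f -> csmooth_on U (cderive v f).
Proof. by move=> [fr fi]; split; exact: smooth_on_derive. Qed.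

Lemma csmooth_on_comp_linear U f (A : V -> V) :
  (forall (h : R) x y, A (h *: x + y) = h *: A x + A y) -> continuous A ->
  csmooth_on U f -> csmooth_on (A @^-1` U) (f \o A).
Proof.
by move=> lA cA [fr fi]; split;
  [exact: (smooth_on_comp_linear lA cA fr) | exact: (smooth_on_comp_linear lA cA fi)].
Qed.

Lemma cderive_comp_linear f (A : V -> V) v x :
  (forall (h : R) x y, A (h *: x + y) = h *: A x + A y) ->
  cderive v (f \o A) x = cderive (A v) f (A x).
Proof.
move=> lA; apply: complex_eqP => /=.
  by apply: (@derive_affine _ _ _ _ (fun y => complex.Re (f y)) A) => h; exact: lA.
by apply: (@derive_affine _ _ _ _ (fun y => complex.Im (f y)) A) => h; exact: lA.
Qed.

Lemma cderive_ext U f g v x : open U -> U x -> (forall y, U y -> f y = g y) ->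
  cderive v f x = cderive v g x.
Proof.
move=> oU Ux fg; apply: complex_eqP => /=.
  by apply: (eq_derive_open v oU Ux) => y Uy; rewrite fg.
by apply: (eq_derive_open v oU Ux) => y Uy; rewrite fg.
Qed.

Lemma cderive_cst v (a : C) x : cderive v (fun=> a) x = 0.
Proof. by apply: complex_eqP => /=; exact: derive_cst. Qed.

Lemma cderiveD U f g v x : csmooth_on U f -> csmooth_on U g -> U x ->
  cderive v (fun y => f y + g y) x = cderive v f x + cderive v g x.
Proof.
move=> [fr fi] [gr gi] Ux; apply: complex_eqP => /=.
  have -> : (fun y => complex.Re (f y + g y)) =
    (fun y => complex.Re (f y)) + (fun y => complex.Re (g y)).
    by apply/funext => y; rewrite cReD.
  apply: deriveD; exact: (@smooth_on_derivable R U _ x v).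
have -> : (fun y => complex.Im (f y + g y)) =
  (fun y => complex.Im (f y)) + (fun y => complex.Im (g y)).
  by apply/funext => y; rewrite cImD.
apply: deriveD; exact: (@smooth_on_derivable R U _ x v).
Qed.

Lemma cderive_conj U f v x : csmooth_on U f -> U x ->
  cderive v (fun y => Num.conj (f y)) x = Num.conj (cderive v f x).
Proof.
move=> [fr fi] Ux; apply: complex_eqP => /=.
  by congr ('D_v _ x); apply/funext => y; rewrite cRe_conj.
have -> : (fun y => complex.Im (Num.conj (f y))) = - (fun y => complex.Im (f y)).
  by apply/funext => y; rewrite cIm_conj.
by apply: deriveN; exact: (@smooth_on_derivable R U _ x v).
Qed.

Lemma cderiveM U f g v x : csmooth_on U f -> csmooth_on U g -> U x ->
  cderive v (fun y => f y * g y) x = cderive v f x * g x + f x * cderive v g x.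
Proof.
move=> [fr fi] [gr gi] Ux.
have d1 := @smooth_on_derivable R U _ x v fr Ux.
have d2 := @smooth_on_derivable R U _ x v fi Ux.
have d3 := @smooth_on_derivable R U _ x v gr Ux.
have d4 := @smooth_on_derivable R U _ x v gi Ux.
apply: complex_eqP.
  rewrite cReD !cReM /=.
  have -> : (fun y => complex.Re (f y * g y)) =
    (fun y => complex.Re (f y)) * (fun y => complex.Re (g y)) -
    (fun y => complex.Im (f y)) * (fun y => complex.Im (g y)).
    by apply/funext => y; rewrite cReM.
  rewrite (deriveB (derivableM d1 d3) (derivableM d2 d4)) (deriveM d1 d3) (deriveM d2 d4).
  rewrite -![_ *: _]/(_ * _).
  move: ('D_v _ x) ('D_v _ x) ('D_v _ x) ('D_v _ x) => a1 a2 a3 a4.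
  by move: (complex.Re _) (complex.Re _) (complex.Im _) (complex.Im _) => ????; ring.
rewrite cImD !cImM /=.
have -> : (fun y => complex.Im (f y * g y)) =
  (fun y => complex.Re (f y)) * (fun y => complex.Im (g y)) +
  (fun y => complex.Im (f y)) * (fun y => complex.Re (g y)).
  by apply/funext => y; rewrite cImM.
rewrite (deriveD (derivableM d1 d4) (derivableM d2 d3)) (deriveM d1 d4) (deriveM d2 d3).
rewrite -![_ *: _]/(_ * _).
move: ('D_v _ x) ('D_v _ x) ('D_v _ x) ('D_v _ x) => a1 a2 a3 a4.
by move: (complex.Re _) (complex.Re _) (complex.Im _) (complex.Im _) => ????; ring.
Qed.

Lemma cderive_linear U f u v (a : R) x : open U -> csmooth_on U f -> U x ->
  cderive (a *: u + v) f x = a%:C * cderive u f x + cderive v f x.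
Proof.
move=> oU [fr fi] Ux; apply: complex_eqP.
  rewrite cReD cReM /= mul0r subr0; exact: (derive_smooth_linear _ _ _ oU Ux fr).
rewrite cImD cImM /= mul0r addr0; exact: (derive_smooth_linear _ _ _ oU Ux fi).
Qed.

Lemma cderive_comm U f u v x : open U -> csmooth_on U f -> U x ->
  cderive u (cderive v f) x = cderive v (cderive u f) x.
Proof.
move=> oU [fr fi] Ux; apply: complex_eqP => /=.
  exact: (derive_smooth_comm _ _ oU Ux fr).
exact: (derive_smooth_comm _ _ oU Ux fi).
Qed.

Lemma cderive0_const U f : convex_subset U ->
  (forall x, U x -> forall v, derivable (fun y => complex.Re (f y)) x v /\
     derivable (fun y => complex.Im (f y)) x v) ->
  (forall x, U x -> forall v, cderive v f x = 0) ->
  forall x y, U x -> U y -> f x = f y.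
Proof.
move=> cU df D0 x y Ux Uy; apply: complex_eqP.
  apply: (derive0_const (f := fun y => complex.Re (f y)) cU _ Ux Uy) => z Uz v.
  split; first by have [] := df z Uz v.
  by have /(congr1 (@complex.Re R)) := D0 z Uz v.
apply: (derive0_const (f := fun y => complex.Im (f y)) cU _ Ux Uy) => z Uz v.
split; first by have [] := df z Uz v.
by have /(congr1 (@complex.Im R)) := D0 z Uz v.
Qed.

Definition cis (t : R) : C := cos t +i* sin t.

Lemma cisD s t : cis (s + t) = cis s * cis t.
Proof.
by apply: complex_eqP; rewrite ?cReM ?cImM /= ?cosD ?sinD // addrC mulrC (mulrC (sin t)).
Qed.

Lemma cis0 : cis 0 = 1.
Proof. by rewrite /cis cos0 sin0. Qed.

Lemma cis_conj t : cis t * Num.conj (cis t) = 1.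
Proof.
apply: complex_eqP; rewrite ?cReM ?cImM /=; last by ring.
by rewrite mulrN opprK -!expr2 cos2Dsin2.
Qed.

Lemma csmooth_on_cis U (phi : V -> R) : open U -> smooth_on U phi ->
  csmooth_on U (fun x => cis (phi x)).
Proof.
by move=> oU sp; split; [exact: (smooth_on_cos oU sp) | exact: (smooth_on_sin oU sp)].
Qed.

Lemma cderive_cis U (phi : V -> R) v x : smooth_on U phi -> U x ->
  cderive v (fun y => cis (phi y)) x = 'i%C * ('D_v phi x)%:C * cis (phi x).
Proof.
move=> sp Ux; have dp := @smooth_on_derivable R U _ x v sp Ux.
have [_ dc] := derive_comp1 dp (is_derive_cos (phi x)).
have [_ ds] := derive_comp1 dp (is_derive_sin (phi x)).
apply: complex_eqP; rewrite !(cReM, cImM) /=.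
  by rewrite [LHS]dc; move: ('D_v phi x) => ?; ring.
by rewrite [LHS]ds; move: ('D_v phi x) => ?; ring.
Qed.

End ComplexSmooth.

(** * Line bundles and local frames *)

Section DotProducts.
Variables (R : realType) (T : lmodType R[i]) (h : {dot T for @Num.conj R[i]}).
Implicit Types u v w : T.

Lemma dotZl a u v : h (a *: u) v = a * h u v.
Proof. exact: linearZl_LR. Qed.

Lemma dotZr a u v : h u (a *: v) = Num.conj a * h u v.
Proof. exact: linearZr_LR. Qed.

Lemma dotDl u v w : h (u + v) w = h u w + h v w.
Proof. exact: linearDl. Qed.

Lemma dotC u v : h u v = Num.conj (h v u).
Proof. by rewrite [LHS](hermC h) expr0 mul1r. Qed.

Lemma dot1_neq0 u : h u u = 1 -> u != 0.
Proof. by apply: contra_eq_neq => ->; rewrite linear0l eq_sym oner_neq0. Qed.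

End DotProducts.

(** In a line, a unit vector spans, and the coefficient is read off by pairing with it. Every
    coordinate computation on fibres goes through this. *)
Lemma unit_span (R : realType) (T : vectType R[i]) (h : {dot T for @Num.conj R[i]})
    (e u : T) : \dim {: T} = 1%N -> h e e = 1 -> u = h u e *: e.
Proof.
move=> dT e1; have e0 := dot1_neq0 e1.
have : u \in <[e]>%VS.
  have -> : <[e]>%VS = fullv; last exact: memvf.
  by apply/eqP; rewrite eqEdim subvf dT dim_vline e0.
by case/vlineP => k ->; rewrite dotZl e1 mulr1.
Qed.

Section LineBundle.
Variable R : realType.
Local Notation C := R[i].
Local Notation V := (phase R).
Variables (L : line_bundle R) (HL : is_line_bundle L).
Implicit Types (s t e : section L) (U W : set V) (x u v : V).

Lemma local_frame x : exists U, exists e,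
  [/\ open U, U x, frame U e, smooth_section U e &
      forall y, U y -> herm L y (e y) (e y) = 1].
Proof.
have [U [e [fe Ux]]] := frame_cover HL x.
exists U, e; split => //; [exact: frame_open HL _ _ fe | exact: frame_smooth HL _ _ fe |].
by move=> y Uy; exact: frame_unit HL _ _ fe y Uy.
Qed.

Lemma line_span x (e u : fib L x) : herm L x e e = 1 -> u = herm L x u e *: e.
Proof. by apply: unit_span; exact: fib_line HL x. Qed.

Lemma smooth_section_ext U s t : open U -> (forall x, U x -> s x = t x) ->
  smooth_section U s -> smooth_section U t.
Proof.
move=> oU st ss W e fe; apply: (csmooth_on_ext _ _ (ss W e fe)).
  by apply: openI oU _; exact: frame_open HL _ _ fe.
by move=> x [Ux _]; rewrite st.
Qed.

Lemma smooth_section_sub U W s : W `<=` U -> smooth_section U s -> smooth_section W s.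
Proof.
move=> WU ss W' e fe; apply: csmooth_on_sub (ss W' e fe).
by move=> x [/WU].
Qed.

Lemma smooth_section_local U s :
  (forall x, U x -> exists2 W, W x & smooth_section W s) -> smooth_section U s.
Proof.
move=> loc W' e fe; apply: csmooth_on_local => x [Ux Wx].
by have [W Wx' sW] := loc x Ux; exists (W `&` W') => //; exact: sW.
Qed.

(** Smoothness is tested against atlas frames only; in such a frame e, the product is h(s, e) times
    the conjugate of h(t, e). *)
Lemma smooth_section_dot U s t : open U -> smooth_section U s -> smooth_section U t ->
  csmooth_on U (fun x => herm L x (s x) (t x)).
Proof.
move=> oU ss st; apply: csmooth_on_local => x Ux.
have [W [e [oW Wx fe se e1]]] := local_frame x.
exists (U `&` W) => //; have oUW := openI oU oW.
apply: (csmooth_on_ext oUW _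
  (csmooth_onM oUW (ss W e fe) (csmooth_on_conj oUW (st W e fe)))).
move=> y [Uy Wy]; rewrite {2}(line_span (s y) (e1 y Wy)).
by rewrite {2}(line_span (t y) (e1 y Wy)) dotZl dotZr e1 // mulr1.
Qed.

Lemma smooth_sectionZ U (f : V -> C) s : open U -> csmooth_on U f ->
  smooth_section U s -> smooth_section U (fun x => f x *: s x).
Proof.
move=> oU sf ss W e fe; have oUW : open (U `&` W).
  by apply: openI oU _; exact: frame_open HL _ _ fe.
have sf' : csmooth_on (U `&` W) f by apply: csmooth_on_sub sf => y [].
apply: (csmooth_on_ext oUW _ (csmooth_onM oUW sf' (ss W e fe))) => y _.
by rewrite dotZl.
Qed.

Lemma nabla_scale U (f : V -> C) s v x : open U -> csmooth_on U f ->
  smooth_section U s -> U x ->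
  nabla v (fun y => f y *: s y) x = cderive v f x *: s x + f x *: nabla v s x.
Proof. by move=> oU sf ss; exact: (nabla_Leibniz HL v oU sf ss). Qed.

Lemma nabla_ext U s t v x : open U -> smooth_section U s ->
  (forall y, U y -> s y = t y) -> U x -> nabla v s x = nabla v t x.
Proof. by move=> oU ss st; exact: (nabla_local HL v oU ss st). Qed.

Section Frame.
Variables (U : set V) (e : section L).
Hypotheses (oU : open U) (se : smooth_section U e).
Hypothesis (e1 : forall y, U y -> herm L y (e y) (e y) = 1).

Definition conn_form v x : C := herm L x (nabla v e x) (e x).

Lemma nabla_frame v x : U x -> nabla v e x = conn_form v x *: e x.
Proof. by move=> Ux; exact: (line_span _ (e1 Ux)). Qed.

Lemma conn_form_smooth v : csmooth_on U (conn_form v).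
Proof. exact: (smooth_section_dot oU (nabla_smooth HL v oU se) se). Qed.

(** This is the derivative of the constant function h(e, e) = 1, expanded by unitarity of the
    connection. *)
Lemma conn_form_imaginary v x : U x -> conn_form v x + Num.conj (conn_form v x) = 0.
Proof.
move=> Ux; rewrite /conn_form -dotC -(nabla_unitary HL v oU se se Ux).
rewrite (@cderive_ext _ U _ (fun=> 1) v x oU Ux) ?cderive_cst //.
Qed.

Lemma conn_form_ImE v x : U x -> conn_form v x = 'i%C * (complex.Im (conn_form v x))%:C.
Proof.
move=> /(conn_form_imaginary v) E; apply: complex_eqP.
  move/(congr1 (@complex.Re R)) : E; rewrite cReD cRe_conj cReM /=; lra.
by rewrite cImM /=; ring.
Qed.

Lemma conn_form_linear (a : R) u v x : U x ->
  conn_form (a *: u + v) x = a%:C * conn_form u x + conn_form v x.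
Proof.
by move=> Ux; rewrite /conn_form (nabla_linear HL a u v oU se Ux) dotDl dotZl.
Qed.

Lemma nabla_coef (c : V -> C) v x : csmooth_on U c -> U x ->
  nabla v (fun y => c y *: e y) x = (cderive v c x + c x * conn_form v x) *: e x.
Proof.
move=> sc Ux; rewrite (nabla_scale v oU sc se Ux) (nabla_frame v Ux).
by rewrite scalerA scalerDl.
Qed.

(** The curvature is the differential of the connection form: the quadratic terms cancel because
    scalars commute. *)
Lemma curvature_frame F u v x : has_curvature L F -> U x ->
  F x u v = cderive u (conn_form v) x - cderive v (conn_form u) x.
Proof.
move=> HF Ux; have := HF U e oU se x Ux u v.
have E w w' : nabla w (nabla w' e) x =
    (cderive w (conn_form w') x + conn_form w' x * conn_form w x) *: e x.
  rewrite -nabla_coef //; last exact: conn_form_smooth.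
  apply: (nabla_ext w oU (nabla_smooth HL w' oU se) _ Ux) => y Uy.
  exact: (nabla_frame w' Uy).
rewrite !E -scalerBl => /(congr1 (fun w => herm L x w (e x))).
rewrite !dotZl e1 // !mulr1 => <-.
by rewrite (mulrC (conn_form v x)) opprD addrACA subrr addr0.
Qed.

End Frame.

End LineBundle.

(** * Bundle maps *)

Section LocalMaps.
Variable R : realType.
Local Notation C := R[i].
Local Notation V := (phase R).
Implicit Types (L : line_bundle R) (U W : set V) (x y : V).

(** [Phi] is total but arbitrary over points outside [U], so sections are tested only on open sets
    [W] inside [U]. *)
Record local_map L L' (f : V -> V) U (Phi : forall x, fib L x -> fib L' (f x)) :
    Prop := {
  local_linear : forall x, U x -> linear (Phi x);
  local_unitary : forall x, U x ->
    forall u v, herm L' (f x) (Phi x u) (Phi x v) = herm L x u v;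
  local_smooth : forall W (s : section L) (t : section L'), open W -> W `<=` U ->
    (forall x, W x -> t (f x) = Phi x (s x)) ->
    smooth_section W s -> smooth_section (f @` W) t;
  local_parallel : forall W (s : section L) (t : section L'), open W -> W `<=` U ->
    (forall x, W x -> t (f x) = Phi x (s x)) -> smooth_section W s ->
    forall x, W x -> forall v, nabla ('D_v f x) t (f x) = Phi x (nabla v s x)
}.

Lemma bundle_map_local L L' f (Phi : forall x, fib L x -> fib L' (f x)) U :
  is_bundle_map Phi -> local_map U Phi.
Proof.
move=> HP; split.
- by move=> x _; exact: (map_linear HP).
- by move=> x _; exact: (map_unitary HP).
- by move=> W s t oW _; exact: (map_smooth HP).
- by move=> W s t oW _; exact: (map_parallel HP).
Qed.

Lemma local_bundle_map L L' f (Phi : forall x, fib L x -> fib L' (f x)) :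
  local_map setT Phi -> is_bundle_map Phi.
Proof.
move=> HP; split.
- by move=> x; exact: (local_linear HP).
- by move=> x; exact: (local_unitary HP).
- by move=> W s t oW; exact: (local_smooth HP oW).
- by move=> W s t oW; exact: (local_parallel HP oW).
Qed.

Lemma local_map_sub L L' f (Phi : forall x, fib L x -> fib L' (f x)) U W :
  W `<=` U -> local_map U Phi -> local_map W Phi.
Proof.
move=> WU HP; split.
- by move=> x /WU; exact: (local_linear HP).
- by move=> x /WU; exact: (local_unitary HP).
- by move=> W' s t oW W'W; apply: (local_smooth HP oW) => x /W'W /WU.
- by move=> W' s t oW W'W; apply: (local_parallel HP oW) => x /W'W /WU.
Qed.

Lemma local_mapZ L L' f (Phi : forall x, fib L x -> fib L' (f x)) U x (a : C)
    (u : fib L x) : local_map U Phi -> U x -> Phi x (a *: u) = a *: Phi x u.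
Proof.
move=> HP Ux; have lP := local_linear HP Ux.
have P0 : Phi x 0 = 0.
  have /eqP := lP 1 0 0; rewrite scaler0 addr0 scale1r.
  by rewrite -subr_eq0 opprD addrA subrr sub0r oppr_eq0 => /eqP.
by have := lP a u 0; rewrite P0 !addr0.
Qed.

Lemma unit_section L : is_line_bundle L ->
  exists e : section L, forall x, herm L x (e x) (e x) = 1.
Proof.
move=> HL; have H x : exists u : fib L x, herm L x u u = 1.
  by have [U [e [_ Ux _ _ e1]]] := local_frame HL x; exists (e x); exact: e1.
by exists (fun x => sval (cid (H x))) => x; exact: svalP (cid (H x)).
Qed.

Section Push.
Variables (L L' : line_bundle R) (f g : V -> V).
Hypotheses (fK : cancel f g) (gK : cancel g f).

(** The value at [y] is computed in the fibre over [f (g y)] and transported to the fibre over [y].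
    At [y = f x] the transport becomes trivial, by uniqueness of identity proofs on the base. *)
Lemma push_section (Phi : forall x, fib L x -> fib L' (f x)) (s : section L) :
  exists t : section L', forall x, t (f x) = Phi x (s x).
Proof.
exists (fun y => eq_rect (f (g y)) (fun z => fib L' z : Type) (Phi (g y) (s (g y))) y (gK y)).
move=> x; move: (gK (f x)); rewrite (fK x) => p.
by rewrite (eq_irrelevance p (erefl _)).
Qed.

Hypotheses (HL : is_line_bundle L) (HL' : is_line_bundle L').
Hypothesis f_open : forall W, open W -> open (f @` W).
Hypothesis f_surj : forall x w, exists v, 'D_v f x = w.

(** If e is a frame with connection form alpha, its images under both maps have covariant derivative
    alpha times themselves, so their Hermitian product has derivative (alpha + conj alpha) times
    itself, which is 0. That product is the ratio of the maps. *)
Lemma local_map_ratio U (Phi Psi : forall x, fib L x -> fib L' (f x)) :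
  open U -> convex_subset (f @` U) -> local_map U Phi -> local_map U Psi ->
  exists c : C, forall x, U x -> forall u, Phi x u = c *: Psi x u.
Proof.
move=> oU cU HP HQ; have [e0 e01] := unit_section HL.
(* The section [e0] is a pointwise choice without any regularity; [loc] shows that [r] is
   nevertheless given locally by smooth frames. *)
pose r x := herm L' (f x) (Phi x (e0 x)) (Psi x (e0 x)).
have rE x u : U x -> Phi x u = r x *: Psi x u.
  move=> Ux; rewrite (line_span HL u (e01 x)) (local_mapZ _ _ HP Ux) (local_mapZ _ _ HQ Ux).
  rewrite scalerA mulrC -scalerA; congr (_ *: _).
  by apply: (line_span HL'); rewrite (local_unitary HQ Ux).
have loc y : (f @` U) y -> exists W c', [/\ open W, W y, csmooth_on W c',
    (forall z, W z -> r (g z) = c' z) & forall v, cderive v c' y = 0].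
  case=> x Ux <-; have [W [e [oW Wx fe se e1]]] := local_frame HL x.
  have [t Ht] := push_section Phi e; have [t' Ht'] := push_section Psi e.
  have oUW := openI oU oW.
  have UWU : U `&` W `<=` U by move=> ? [].
  have se' : smooth_section (U `&` W) e by apply: smooth_section_sub se => ? [].
  have st := local_smooth HP oUW UWU (fun x _ => Ht x) se'.
  have st' := local_smooth HQ oUW UWU (fun x _ => Ht' x) se'.
  have ofW := f_open oUW.
  have fUW : (f @` (U `&` W)) (f x) by exists x.
  exists (f @` (U `&` W)), (fun z => herm L' z (t z) (t' z)); split => //.
  - exact: (smooth_section_dot HL' ofW st st').
  - move=> _ [z [Uz Wz] <-]; rewrite fK Ht Ht' (rE _ _ Uz) dotZl.
    by rewrite (local_unitary HQ Uz) e1 // mulr1.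
  - move=> w; have [v <-] := f_surj x w.
    rewrite (nabla_unitary HL' _ ofW st st' fUW).
    rewrite (local_parallel HP oUW UWU (fun x _ => Ht x) se' (conj Ux Wx)).
    rewrite (local_parallel HQ oUW UWU (fun x _ => Ht' x) se' (conj Ux Wx)).
    rewrite (nabla_frame HL e1 v Wx) Ht Ht' (local_mapZ _ _ HP Ux) (local_mapZ _ _ HQ Ux).
    rewrite dotZl dotZr -mulrDl.
    by rewrite (conn_form_imaginary HL oW se e1 v Wx) mul0r.
(* Over an empty [U] any constant will do. *)
have [U0|] := pselect (exists x, U x); last by move=> nU; exists 0 => x Ux; case: nU; exists x.
case: U0 => x0 Ux0; exists (r x0) => x Ux u; rewrite rE //; congr (_ *: _).
suff E : r (g (f x)) = r (g (f x0)) by rewrite !fK in E.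
apply: (@cderive0_const R (f @` U) (r \o g) cU _ _ (f x) (f x0)); try by [exists x | exists x0].
- move=> y fUy v; have [W [c [oW Wy [sr si] rc _]]] := loc y fUy.
  split.
    apply: (eq_derivable_open (f := fun z => complex.Re (c z)) oW Wy).
      by move=> z Wz; rewrite /= rc.
    exact: (@smooth_on_derivable R W _ y v sr Wy).
  apply: (eq_derivable_open (f := fun z => complex.Im (c z)) oW Wy).
    by move=> z Wz; rewrite /= rc.
  exact: (@smooth_on_derivable R W _ y v si Wy).
- move=> y fUy v; have [W [c [oW Wy _ rc Dc]]] := loc y fUy.
  rewrite -[RHS](Dc v); by apply: (cderive_ext v oW Wy) => z Wz; rewrite /= rc.
Qed.

End Push.

(** A section related to [s] by [c *: Phi] becomes related by [Phi] after multiplication by the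
    conjugate of [c]; smoothness and parallelism are then scaled back. *)
Lemma local_map_scale L L' f U (Phi : forall x, fib L x -> fib L' (f x)) (c : C) :
  is_line_bundle L' -> (forall W, open W -> open (f @` W)) ->
  c * Num.conj c = 1 -> local_map U Phi -> local_map U (fun x u => c *: Phi x u).
Proof.
move=> HL' f_open c1 HP.
have c1' : Num.conj c * c = 1 by rewrite mulrC.
have key W (s : section L) (t : section L') : open W -> W `<=` U ->
    (forall x, W x -> t (f x) = c *: Phi x (s x)) -> smooth_section W s ->
    (forall x, W x -> Num.conj c *: t (f x) = Phi x (s x)) /\
    smooth_section (f @` W) (fun x => Num.conj c *: t x).
  move=> oW WU tE ss.
  have E x : W x -> Num.conj c *: t (f x) = Phi x (s x).
    by move=> Wx; rewrite tE // scalerA c1' scale1r.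
  split; first by [].
  exact: (local_smooth HP (t := fun x => Num.conj c *: t x) oW WU E ss).
split.
- by move=> x Ux k u v; rewrite (local_linear HP Ux) scalerDr !scalerA mulrC.
- by move=> x Ux u v; rewrite dotZl dotZr mulrA c1 mul1r (local_unitary HP Ux).
- move=> W s t oW WU tE ss; have [E st] := key W s t oW WU tE ss; have ofW := f_open W oW.
  apply: (smooth_section_ext HL' ofW _ (smooth_sectionZ HL' ofW (@csmooth_on_cst R _ c) st)).
  by move=> x Wx; rewrite scalerA c1 scale1r.
- move=> W s t oW WU tE ss x Wx v; have [E st] := key W s t oW WU tE ss.
  have ofW := f_open W oW; have fWx : (f @` W) (f x) by exists x.
  rewrite -(local_parallel HP (t := fun x => Num.conj c *: t x) oW WU E ss Wx v).
  have -> : nabla ('D_v f x) t (f x) =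
      nabla ('D_v f x) (fun y => c *: (Num.conj c *: t y)) (f x).
    apply/esym/(nabla_ext HL' _ ofW (smooth_sectionZ HL' ofW (@csmooth_on_cst R _ c) st) _ fWx).
    by move=> y Wy; rewrite scalerA c1 scale1r.
  rewrite (nabla_scale HL' _ ofW (@csmooth_on_cst R _ c) st fWx).
  by rewrite cderive_cst scale0r add0r.
Qed.

Lemma bundle_map_scale L L' f (Phi : forall x, fib L x -> fib L' (f x)) (c : C) :
  is_line_bundle L' -> (forall W, open W -> open (f @` W)) ->
  c * Num.conj c = 1 -> is_bundle_map Phi -> is_bundle_map (fun x u => c *: Phi x u).
Proof.
move=> HL' f_open c1 /(@bundle_map_local _ _ _ _ setT) HP.
exact/local_bundle_map/local_map_scale.
Qed.

(** The intermediate section comes from [push_section]. The chain rule is a hypothesis because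
    directional derivatives do not compose in general; in each use one of the base maps is the
    identity. *)
Lemma bundle_map_comp L L' L'' f f' g (Phi : forall x, fib L x -> fib L' (f x))
    (Psi : forall x, fib L' x -> fib L'' (g x)) :
  cancel f f' -> cancel f' f -> (forall W, open W -> open (f @` W)) ->
  (forall x v, 'D_v (g \o f) x = 'D_('D_v f x) g (f x)) ->
  is_bundle_map Phi -> is_bundle_map Psi ->
  @is_bundle_map R L L'' (g \o f) (fun x u => Psi (f x) (Phi x u)).
Proof.
move=> fK f'K f_open chain HP HQ; split.
- by move=> x k u v; rewrite (map_linear HP) (map_linear HQ).
- by move=> x u v; rewrite /= (map_unitary HQ) (map_unitary HP).
- move=> U s t oU tE ss; have [t1 t1E] := push_section fK f'K Phi s.
  rewrite -image_comp.
  apply: (map_smooth HQ (f_open _ oU) _ (map_smooth HP oU (fun x _ => t1E x) ss)).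
  by move=> _ [x Ux <-]; rewrite t1E -tE.
- move=> U s t oU tE ss x Ux v; have [t1 t1E] := push_section fK f'K Phi s.
  have st1 := map_smooth HP oU (fun x _ => t1E x) ss.
  rewrite chain -(map_parallel HP oU (fun x _ => t1E x) ss Ux).
  apply: (map_parallel HQ (f_open _ oU) _ st1); last by exists x.
  by move=> _ [z Uz <-]; rewrite t1E -tE.
Qed.

Lemma bundle_map_comp_id L L' L'' (Phi : forall x, fib L x -> fib L' x)
    (Psi : forall x, fib L' x -> fib L'' x) :
  @is_bundle_map R L L' id Phi -> @is_bundle_map R L' L'' id Psi ->
  @is_bundle_map R L L'' id (fun x u => Psi x (Phi x u)).
Proof.
have io W : open W -> open (id @` W) by rewrite image_id.
have chain (x v : V) : 'D_v (id \o id : V -> V) x =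
    'D_('D_v (id : V -> V) x) (id : V -> V) (id x) by rewrite !derive_id.
exact: (bundle_map_comp (fun _ => erefl) (fun _ => erefl) io chain).
Qed.

Lemma local_map_ratio_id L L' U (Phi Psi : forall x, fib L x -> fib L' (id x)) :
  is_line_bundle L -> is_line_bundle L' ->
  open U -> convex_subset U -> local_map U Phi -> local_map U Psi ->
  exists c : C, forall x, U x -> forall u, Phi x u = c *: Psi x u.
Proof.
move=> HL HL' oU cU; apply: (@local_map_ratio _ _ _ id) => //.
- by move=> W; rewrite image_id.
- by move=> x w; exists w; exact: derive_id.
- by rewrite image_id.
Qed.

Lemma local_isomorphism L L' F x0 : is_line_bundle L -> is_line_bundle L' ->
  has_curvature L F -> has_curvature L' F ->
  exists2 r : R, 0 < r &
    exists Phi : forall x, fib L x -> fib L' x, local_map (f := id) (ball x0 r) Phi.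
Proof.
move=> HL HL' cL cL'.
have [W [e [oW Wx _ se e1]]] := local_frame HL x0.
have [W' [e' [oW' Wx' _ se' e1']]] := local_frame HL' x0.
have := open_nbhs_nbhs (conj (openI oW oW') (conj Wx Wx')).
move=> /nbhs_ballP[r /= r0 rW]; exists r => //.
pose B := ball x0 r.
have oB : open B by exact: ball_open.
have Bx : B x0 by exact: ballxx.
have cB : convex_subset B by exact: convex_ball.
have BW : B `<=` W by move=> y /rW[].
have BW' : B `<=` W' by move=> y /rW[].
have {}se := smooth_section_sub BW se; have {}se' := smooth_section_sub BW' se'.
have {}e1 y : B y -> herm L y (e y) (e y) = 1 by move/BW; exact: e1.
have {}e1' y : B y -> herm L' y (e' y) (e' y) = 1 by move/BW'; exact: e1'.
pose a := conn_form e; pose a' := conn_form e'.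
have sa v : csmooth_on B (a v) := conn_form_smooth HL oB se v.
have sa' v : csmooth_on B (a' v) := conn_form_smooth HL' oB se' v.
(* Both connection forms are imaginary, so a - a' = i b with [b] real; [b] is closed because the
   curvatures agree. *)
pose b v x := complex.Im (a v x) - complex.Im (a' v x).
have [|||phi sphi Dphi] := @poincare R B x0 b oB cB Bx.
- by move=> v; apply: (smooth_onB oB); [have [] := sa v | have [] := sa' v].
- move=> k u v x Ux; rewrite /b /a /a' (conn_form_linear HL oB se) //.
  by rewrite (conn_form_linear HL' oB se') // !cImD !cImM /=; ring.
- move=> u v x Ux.
  have := curvature_frame HL oB se e1 u v cL Ux.
  rewrite (curvature_frame HL' oB se' e1' u v cL' Ux) -/a -/a'.
  move/(congr1 (@complex.Im R)); rewrite /= .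
  have d w z := @smooth_on_derivable R B _ x z (sa w).2 Ux.
  have d' w z := @smooth_on_derivable R B _ x z (sa' w).2 Ux.
  rewrite /b.
  have E w z : 'D_z (fun y => complex.Im (a w y) - complex.Im (a' w y)) x =
     'D_z (fun y => complex.Im (a w y)) x - 'D_z (fun y => complex.Im (a' w y)) x.
    exact: (deriveB (d w z) (d' w z)).
  rewrite !E.
  move: ('D_u _ _) ('D_v _ _) ('D_u _ _) ('D_v _ _) => p q p' q'.
  lra.
pose c y := cis (phi y).
have sc : csmooth_on B c := csmooth_on_cis oB sphi.
(* This equation gives c e' the connection form a (a - a' from c, plus a' from e'), so that e -> c
   e' is parallel. *)
have Dc v x : B x -> cderive v c x = c x * (a v x - a' v x).
  move=> Ux; rewrite /c (cderive_cis v sphi Ux) Dphi // mulrC; congr (_ * _).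
  rewrite /a (conn_form_ImE HL oB se e1 v Ux) /a' (conn_form_ImE HL' oB se' e1' v Ux).
  by rewrite -mulrBr -rmorphB.
exists (fun x u => (herm L x u (e x) * c x) *: e' x).
have key U s t : open U -> U `<=` B ->
    (forall x, U x -> t x = (herm L x (s x) (e x) * c x) *: e' x) ->
    smooth_section U s ->
    [/\ csmooth_on U (fun x => herm L x (s x) (e x)),
        smooth_section U e', smooth_section U e,
        csmooth_on U (fun x => herm L x (s x) (e x) * c x) &
        smooth_section U (fun x => (herm L x (s x) (e x) * c x) *: e' x)].
  move=> oU UB tE ss.
  have sse := smooth_section_sub UB se; have sse' := smooth_section_sub UB se'.
  have s1 := smooth_section_dot HL oU ss sse; have s2 := csmooth_on_sub UB sc.
  have s3 := csmooth_onM oU s1 s2.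
  by split; [exact: s1 | exact: sse' | exact: sse | exact: s3 |
    exact: (smooth_sectionZ HL' oU s3 sse')].
split.
- move=> x _ k u v; rewrite dotDl dotZl mulrDl scalerDl.
  by rewrite -mulrA -scalerA.
- move=> x Bx' u v; rewrite dotZl dotZr e1' // mulr1 rmorphM /=.
  rewrite mulrACA cis_conj mulr1.
  by rewrite {2}(line_span HL v (e1 x Bx')) dotZr mulrC.
- move=> U s t oU UB tE ss; rewrite image_id.
  have [_ _ _ _ st] := key U s t oU UB tE ss.
  by apply: (smooth_section_ext HL' oU _ st) => x Ux; rewrite tE.
- move=> U s t oU UB tE ss x Ux v; rewrite derive_id.
  have [s1 s3 s4 s5 st] := key U s t oU UB tE ss; have s2 := csmooth_on_sub UB sc.
  have e1U y : U y -> herm L y (e y) (e y) = 1 by move/UB; exact: e1.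
  have e1U' y : U y -> herm L' y (e' y) (e' y) = 1 by move/UB; exact: e1'.
  have -> : nabla v t x = nabla v (fun y => (herm L y (s y) (e y) * c y) *: e' y) x.
    by apply/esym/(nabla_ext HL' v oU st _ Ux) => y Uy; rewrite tE.
  rewrite (nabla_coef HL' oU s3 e1U' v s5 Ux) (cderiveM v s1 s2 Ux) (Dc _ _ (UB _ Ux)).
  congr (_ *: _).
  have -> : nabla v s x = nabla v (fun y => herm L y (s y) (e y) *: e y) x.
    apply: (nabla_ext HL v oU ss _ Ux) => y Uy.
    exact: (line_span HL (s y) (e1U y Uy)).
  rewrite (nabla_coef HL oU s4 e1U v s1 Ux) dotZl e1U // mulr1 -/(a v x) -/(a' v x).
  ring.
Qed.

End LocalMaps.

(** * Isomorphism of bundles of equal curvature *)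

Section Gluing.
Variable R : realType.
Local Notation C := R[i].
Local Notation V := (phase R).
Variables (L L' : line_bundle R).
Hypotheses (HL : is_line_bundle L) (HL' : is_line_bundle L').
Implicit Types (U W : set V) (x y : V) (Phi Psi : forall x, fib L x -> fib L' x).

Local Notation iso_on := (@local_map R L L' id).

Lemma local_map_glue U Psi :
  (forall x, U x -> exists W, exists Phi, [/\ open W, W x, iso_on W Phi &
     forall y, W y -> forall u, Psi y u = Phi y u]) ->
  iso_on U Psi.
Proof.
move=> loc; split.
- move=> x Ux k u v; have [W [Phi [oW Wx HP PE]]] := loc x Ux.
  by rewrite !PE //; exact: (local_linear HP).
- move=> x Ux u v; have [W [Phi [oW Wx HP PE]]] := loc x Ux.
  by rewrite !PE //; exact: (local_unitary HP).
- move=> U' s t oU' UU' tE ss; rewrite image_id.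
  apply: smooth_section_local => x Ux.
  have [W [Phi [oW Wx HP PE]]] := loc x (UU' x Ux).
  exists (U' `&` W) => //.
  have [W1 W2] : U' `&` W `<=` U' /\ U' `&` W `<=` W by split=> ? [].
  have tE' y : (U' `&` W) y -> t (id y) = Phi y (s y) by case=> Uy Wy; rewrite tE // PE.
  have := local_smooth HP (openI oU' oW) W2 tE' (smooth_section_sub W1 ss).
  by rewrite image_id.
- move=> U' s t oU' UU' tE ss x Ux v.
  have [W [Phi [oW Wx HP PE]]] := loc x (UU' x Ux).
  have [W1 W2] : U' `&` W `<=` U' /\ U' `&` W `<=` W by split=> ? [].
  have tE' y : (U' `&` W) y -> t (id y) = Phi y (s y) by case=> Uy Wy; rewrite tE // PE.
  rewrite PE //.
  exact: (local_parallel HP (openI oU' oW) W2 tE' (smooth_section_sub W1 ss) (conj Ux Wx)).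
Qed.

Lemma iso_on_scale U Phi (c : C) : c * Num.conj c = 1 -> iso_on U Phi ->
  iso_on U (fun x u => c *: Phi x u).
Proof.
by apply: (local_map_scale (f := id) HL') => W; rewrite image_id.
Qed.

Lemma ratio_unit U Phi Psi (c : C) x : iso_on U Phi -> iso_on U Psi -> U x ->
  (forall u, Phi x u = c *: Psi x u) -> c * Num.conj c = 1.
Proof.
move=> HP HQ Ux E; have [e e1] := unit_section HL.
have := local_unitary HP Ux (e x) (e x).
by rewrite E dotZl dotZr (local_unitary HQ Ux) e1 mulr1.
Qed.

(* The tubes of equal radius around two adjacent segments have the tube around
   their union as union, and a convex intersection. *)
Definition tube x (s t e : R) : set V :=
  [set y | exists2 a : R, s <= a <= t & ball (a *: x) e y].

Lemma tube_open x s t e : open (tube x s t e).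
Proof.
have -> : tube x s t e = \bigcup_(a in [set a | s <= a <= t]) ball (a *: x) e.
  by apply/seteqP; split=> y [a Ha By]; exists a.
apply: bigcup_open => a _; exact: ball_open.
Qed.

Lemma tube_convex x s t e : convex_subset (tube x s t e).
Proof.
move=> y z k [a /andP[a0 a1] ya] [b /andP[b0 b1] zb] /andP[k0 k1].
exists (a + k * (b - a)); first by nra.
(* The displacements of y and z from their axis points lie in the ball about 0; their convex
   combination is the displacement of the new point from the axis point of parameter a + k (b -
   a). *)
have : ball 0 e (a *: x - y + k *: (b *: x - z - (a *: x - y))).
  apply: convex_ball; last by rewrite k0.
    by move: ya; rewrite -!ball_normE /ball_ /= sub0r normrN.
  by move: zb; rewrite -!ball_normE /ball_ /= sub0r normrN.
rewrite -!ball_normE /ball_ /= sub0r normrN; congr (_ < _); congr (`|_|).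
rewrite scalerDl -scalerA scalerBl [in RHS]opprD [RHS]addrACA; congr (_ + _).
by rewrite -scalerBr !opprB (addrC y) (addrC y) addrACA.
Qed.

Lemma tube_sub x s t e e' : e <= e' -> tube x s t e `<=` tube x s t e'.
Proof. by move=> ee y [a Ha By]; exists a => //; exact: le_ball By. Qed.

(** The radius is existential because it may shrink at each concatenation. *)
Definition iso_near x (s t : R) : Prop :=
  exists2 e : R, 0 < e & exists Phi, iso_on (tube x s t e) Phi.

(** On the convex overlap the two maps differ by a constant of modulus 1. Once the second map is
    multiplied by it they agree there, and a case distinction glues them. *)
Lemma iso_near_concat x r s t : r <= s -> s <= t ->
  iso_near x r s -> iso_near x s t -> iso_near x r t.
Proof.
move=> rs st [e1 e10 [P1 HP1]] [e2 e20 [P2 HP2]].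
pose e := Num.min e1 e2; have e0 : 0 < e by rewrite lt_min e10.
have {}HP1 : iso_on (tube x r s e) P1.
  by apply: local_map_sub HP1; apply: tube_sub; rewrite ge_min lexx.
have {}HP2 : iso_on (tube x s t e) P2.
  by apply: local_map_sub HP2; apply: tube_sub; rewrite ge_min lexx orbT.
set T1 := tube x r s e in HP1; set T2 := tube x s t e in HP2.
have o1 : open T1 := @tube_open _ _ _ _; have o2 : open T2 := @tube_open _ _ _ _.
have c12 : convex_subset (T1 `&` T2).
  by apply: convex_subsetI; exact: tube_convex.
have [I1 I2] : T1 `&` T2 `<=` T1 /\ T1 `&` T2 `<=` T2 by split=> ? [].
have HP1' := local_map_sub I1 HP1; have HP2' := local_map_sub I2 HP2.
have Ix : (T1 `&` T2) (s *: x).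
  by split; exists s; rewrite ?lexx ?rs ?st //; exact: ballxx.
have [c cE] := local_map_ratio_id HL HL' (openI o1 o2) c12 HP1' HP2'.
have c1 := ratio_unit HP1' HP2' Ix (cE _ Ix).
have HP2c := iso_on_scale c1 HP2.
exists e => //; exists (fun y u => if pselect (T1 y) then P1 y u else c *: P2 y u).
apply: local_map_glue => y [a /andP[ra at_] ya].
have [T1y|nT1y] := pselect (T1 y).
  by exists T1, P1; split => // z T1z u; case: pselect.
exists T2, (fun y u => c *: P2 y u); split => //.
  (* A point of the union outside [T1] has its axis parameter beyond [s], hence lies in [T2]. *)
  have [as_|sa] := leP a s; first by case: nT1y; exists a => //; rewrite ra.
  by exists a => //; rewrite (ltW sa).
by move=> z T2z u; case: pselect => // T1z; exact: cE.
Qed.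

Variable F : V -> V -> V -> C.
Hypotheses (cL : has_curvature L F) (cL' : has_curvature L' F).

Lemma iso_near_short_segment x (a : R) : exists2 d : R, 0 < d &
  forall s t, a - d < s -> t < a + d -> iso_near x s t.
Proof.
have [r r0 [Phi HP]] := local_isomorphism (a *: x) HL HL' cL cL'.
have x1 : 0 < `|x| + 1 by rewrite ltr_pwDr.
have r20 : 0 < r / 2 by rewrite divr_gt0.
(* Half of the radius [r] is spent on moving along the axis, the other half on the thickness of the
   tube. *)
exists (r / 2 / (`|x| + 1)); first by rewrite divr_gt0.
move=> s t sa ta; exists (r / 2) => //; exists Phi; apply: local_map_sub HP.
move=> y [b /andP[sb bt]]; rewrite -!ball_normE /ball_ /= => yb.
rewrite -(subrKA (b *: x)) (splitr r); apply: le_lt_trans (ler_normD _ _) _.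
apply: ler_ltD => //; rewrite -scalerBl normrZ.
have : `|a - b| <= r / 2 / (`|x| + 1).
  by rewrite ler_norml; apply/andP; split; lra.
rewrite ler_pdivlMr // mulrDr mulr1 => h; apply: le_trans h.
by rewrite lerDl.
Qed.

(** Connectedness of [0, 1] as a supremum argument: an isomorphism reaching close to the supremum
    [sup S] is continued past it by the local isomorphism there, unless the supremum is 1. *)
Lemma iso_near_unit_segment x : iso_near x 0 1.
Proof.
pose S := [set t : R | 0 <= t <= 1 /\ iso_near x 0 t].
have S0 : S 0.
  split; first by rewrite lexx ler01.
  by have [d d0] := iso_near_short_segment x 0; apply; rewrite ?sub0r ?add0r // oppr_lt0.
have bS : has_sup S by split; [exists 0 | exists 1 => t [/andP[]]].
have s0 : 0 <= sup S by apply: sup_ubound => //; case: bS.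
have s1 : sup S <= 1 by apply: sup_le_ub; [exists 0 | move=> t [/andP[]]].
have [d d0 Hd] := iso_near_short_segment x (sup S).
have [s Ss sS] := sup_adherent d0 bS.
have ss : s <= sup S by apply: sup_ubound => //; case: bS.
have [/andP[s0' s1'] gs] := Ss.
pose t := Num.min 1 (sup S + d / 2).
have d20 : 0 < d / 2 by rewrite divr_gt0.
have t1 : t <= 1 by rewrite ge_min lexx.
have td : t <= sup S + d / 2 by rewrite ge_min lexx orbT.
have st : s <= t by rewrite le_min s1' /=; lra.
have gt : iso_near x 0 t by apply: (iso_near_concat s0' st gs); apply: Hd => //; lra.
have St : S t by split => //; rewrite t1 (le_trans s0' st).
have ts : t <= sup S by apply: sup_ubound => //; case: bS.
suff <- : t = 1 by [].
move: ts; rewrite /t; case: (leP 1 (sup S + d / 2)) => // _; lra.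
Qed.

Lemma segment_isomorphism x : exists U, exists Phi,
  [/\ open U, convex_subset U, U 0, U x & iso_on U Phi].
Proof.
have [e e0 [Phi HP]] := iso_near_unit_segment x.
exists (tube x 0 1 e), Phi; split => //.
- exact: tube_open.
- exact: tube_convex.
- by exists 0; [rewrite lexx ler01 | rewrite scale0r; exact: ballxx].
- by exists 1; [rewrite lexx ler01 | rewrite scale1r; exact: ballxx].
Qed.

Lemma same_curvature_isomorphic : exists Phi, @is_bundle_map R L L' id Phi.
Proof.
have [e e1] := unit_section HL; have [e' e1'] := unit_section HL'.
have H x : exists p : set V * (forall y, fib L y -> fib L' y),
  [/\ open p.1, convex_subset p.1, p.1 0 /\ p.1 x, iso_on p.1 p.2 &
      p.2 0 (e 0) = e' 0].
  have [U [Phi [oU cU U0 Ux HP]]] := segment_isomorphism x.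
  (* [k] has modulus 1 and measures the defect of [Phi] at the origin; multiplication by its
     conjugate gives the normalization sending [e 0] to [e' 0]. *)
  pose k := herm L' 0 (Phi 0 (e 0)) (e' 0).
  have PE : Phi 0 (e 0) = k *: e' 0 by exact: (line_span HL' _ (e1' 0)).
  have k1 : Num.conj k * Num.conj (Num.conj k) = 1.
    have := local_unitary HP U0 (e 0) (e 0).
    by rewrite PE dotZl dotZr e1 e1' mulr1 conjCK mulrC.
  exists (U, fun y u => Num.conj k *: Phi y u); split => //=.
    exact: iso_on_scale.
  by rewrite PE scalerA -[X in _ * X]conjCK k1 scale1r.
have [G HG] := choice H.
(* The value at [y] uses the map chosen for [y] itself. Near [x] it equals the map chosen for [x]:
   the two domains meet in a convex set containing both 0 and [y], and the ratio is 1 at 0. *)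
exists (fun y u => (G y).2 y u); apply: local_bundle_map; apply: local_map_glue => x _.
have [ox cx [x0 xx] HPx Gx] := HG x.
exists (G x).1, (G x).2; split => // y Gy u.
have [oy cy [y0 yy] HPy Gy'] := HG y.
have [I1 I2] : (G x).1 `&` (G y).1 `<=` (G x).1 /\ (G x).1 `&` (G y).1 `<=` (G y).1.
  by split=> ? [].
have [c cE] := local_map_ratio_id HL HL' (openI ox oy) (convex_subsetI cx cy)
  (local_map_sub I2 HPy) (local_map_sub I1 HPx).
have c1 : c = 1.
  have := cE 0 (conj x0 y0) (e 0); rewrite Gx Gy' => /(congr1 (fun w => herm L' 0 w (e' 0))).
  by rewrite dotZl e1' mulr1.
by rewrite cE // c1 scale1r.
Qed.

End Gluing.

(** * Roots of unity and rotations *)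

Section UnitRoots.
Variables (R : realType) (n : nat).
Hypothesis n2 : (2 <= n)%N.
Local Notation C := R[i].

Let n0 : n%:R != 0 :> R.
Proof. by rewrite pnatr_eq0 -lt0n; exact: ltnW. Qed.

Lemma unit_rootD a b : unit_root R n (a + b) = unit_root R n a * unit_root R n b.
Proof.
by rewrite -[RHS](cisD (angle R n a) (angle R n b)) /unit_root /angle natrD mulrDr mulrDl.
Qed.

Lemma unit_root0 : unit_root R n 0 = 1.
Proof. by rewrite -[RHS](cis0 R) /unit_root /angle mulr0 mul0r. Qed.

Lemma unit_rootM a b : unit_root R n (a * b) = unit_root R n a ^+ b.
Proof. by elim: b => [|b IH]; rewrite ?muln0 ?unit_root0 // mulnS unit_rootD IH exprS. Qed.

Lemma unit_rootn : unit_root R n n = 1.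
Proof. by rewrite /unit_root /angle mulfK // mulr_natl cos2pi sin2pi. Qed.

(** This makes chi_a multiplicative on ['Z_n], where sums are reduced modulo [n]. *)
Lemma unit_root_mod a b : unit_root R n (a * (b %% n)) = unit_root R n (a * b).
Proof.
rewrite [in RHS](divn_eq b n) mulnDr unit_rootD mulnA (mulnC _ n) (unit_rootM n) unit_rootn.
by rewrite expr1n mul1r.
Qed.

Lemma unit_root_conj a : unit_root R n a * Num.conj (unit_root R n a) = 1.
Proof. exact: cis_conj. Qed.

(** Equality would make the cosine of t = 2 pi (b - a) / n equal to 1 = cos t + 2 sin(t / 2)^2,
    whereas t / 2 lies strictly between 0 and pi when a < b. *)
Lemma unit_root_inj a b : (a < n)%N -> (b < n)%N ->
  unit_root R n a = unit_root R n b -> a = b.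
Proof.
wlog ab : a b / (a <= b)%N => [H an bn E|an bn E].
  by case/orP: (leq_total a b) => ?; [apply: H | apply/esym/H].
have : unit_root R n (b - a) = 1.
  have : unit_root R n a * unit_root R n (b - a) = unit_root R n a * 1.
    by rewrite -unit_rootD subnKC // mulr1.
  apply: mulfI; apply/eqP => a0; have := unit_root_conj a.
  by rewrite a0 mul0r => /eqP; rewrite eq_sym oner_eq0.
move/(congr1 (@complex.Re R)) => /=.
set t := angle R n (b - a) => ct.
have [|ba] := posnP (b - a)%N.
  by move/eqP; rewrite subn_eq0 => ba; apply/eqP; rewrite eqn_leq ab.
have nR : 0 < n%:R :> R by rewrite ltr0n; exact: ltnW.
have s0 : 0 < sin (t / 2).
  apply: sin_gt0_pi; rewrite /t /angle; apply/andP; split.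
    by rewrite !divr_gt0 // !mulr_gt0 ?pi_gt0 ?ltr0n.
  rewrite ltr_pdivrMr // ltr_pdivrMr // -mulrA (mulrC 2) -mulrA mulrC.
  rewrite mulrC -mulrA ltr_pM2l ?pi_gt0 //.
  rewrite mulrC ltr_pM2l // ltr_nat.
  by apply: leq_ltn_trans (leq_subr _ _) bn.
have : cos t = 1 - 2 * sin (t / 2) ^+ 2.
  have {1}-> : t = t / 2 + t / 2 by rewrite -splitr.
  rewrite cosD -!expr2; have := cos2Dsin2 (t / 2).
  by move: (cos _ ^+ 2) (sin _ ^+ 2) => p q; lra.
rewrite ct => E'; exfalso; have := exprn_gt0 2 s0; move: (sin _ ^+ 2) E' => q; lra.
Qed.

(** The n values of [unit_root] are distinct roots of X^n - 1; a further root would exceed its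
    degree. *)
Lemma unity_root_unit_root (z : C) : z ^+ n = 1 -> exists2 a, (a < n)%N & z = unit_root R n a.
Proof.
move=> zn; have [/mapP[a]|nz] := boolP (z \in [seq unit_root R n a | a <- iota 0 n]).
  by rewrite mem_iota add0n => an ->; exists a.
pose rs := z :: [seq unit_root R n a | a <- iota 0 n].
have n_gt0 : (0 < n)%N by exact: ltnW.
have pn0 : 'X^n - 1%:P != 0 :> {poly C} by rewrite -size_poly_gt0 size_XnsubC.
have Urs : uniq rs.
  rewrite /= nz map_inj_in_uniq ?iota_uniq // => a b.
  by rewrite !mem_iota !add0n; exact: unit_root_inj.
have Rrs : all (root ('X^n - 1%:P : {poly C})) rs.
  apply/allP => w; rewrite inE => /orP[/eqP ->|/mapP[a _ ->]].
    by rewrite rootE !hornerE zn subrr.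
  by rewrite rootE !hornerE -unit_rootM mulnC unit_rootM unit_rootn expr1n subrr.
have := max_poly_roots pn0 Rrs Urs.
by rewrite size_XnsubC // /= size_map size_iota ltnn.
Qed.

(** The modulus built into ['Z_n] is [(Zp_trunc n).+2], which is [n] for n >= 2. *)
Lemma val_Zp_add (k l : 'Z_n) : (k + l)%R = ((k + l) %% n)%N :> nat.
Proof. by congr (_ %% _)%N; exact: Zp_cast. Qed.

Lemma val_Zp_1 : (1 : 'Z_n) = 1%N :> nat.
Proof. by rewrite /= Zp_cast // modn_small. Qed.

End UnitRoots.

Lemma bounded_linear_continuous (R : realType) (W : normedModType R) (A : W -> W) (M : R) :
  (forall (h : R) x y, A (h *: x + y) = h *: A x + A y) ->
  (forall x, `|A x| <= M * `|x|) -> continuous A.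
Proof.
move=> lA bA x; apply/cvgrPdist_lt => e e0.
have M0 : 0 < `|M| + 1 by rewrite ltr_pwDr.
apply/nbhs_ballP; exists (e / (`|M| + 1)) => /=; first by rewrite divr_gt0.
move=> y; rewrite -ball_normE /ball_ /= ltr_pdivlMr // => xy.
have -> : A x - A y = A (x - y).
  by rewrite -scaleN1r addrC -lA scaleN1r addrC.
apply: le_lt_trans (bA _) _; rewrite mulrC; apply: le_lt_trans xy.
by apply: ler_wpM2l => //; apply: le_trans (ler_norm M) _; rewrite lerDl.
Qed.

Section Rotations.
Variables (R : realType) (n : nat).
Hypothesis n2 : (2 <= n)%N.
Local Notation V := (phase R).
Implicit Types (k l : 'Z_n) (x y v : V).

Lemma rotation_linear k (h : R) x y :
  rotation k (h *: x + y) = h *: rotation k x + rotation k y.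
Proof.
apply/rowP => j; rewrite !mxE.
by case: j => -[|[|[|[|j]]]] jP //=; ring.
Qed.

Lemma rotation_bounded k x : `|rotation k x| <= 2 * `|x|.
Proof.
rewrite [leLHS]/Num.Def.normr /= mx_normrE.
apply: bigmax_le => [|[i j] _]; first by rewrite mulr_ge0.
(* The norm is the maximum of the entries, and each rotated entry has two terms with coefficients at
   most 1: hence the factor 2. *)
have key (c s a b : R) : `|c| <= 1 -> `|s| <= 1 -> `|a| <= `|x| -> `|b| <= `|x| ->
    `|c * a + s * b| <= 2 * `|x|.
  move=> c1 s1 ax bx; apply: le_trans (ler_normD _ _) _.
  rewrite mulrDl mul1r !normrM; apply: lerD.
    by apply: le_trans ax; exact: ler_piMl.
  by apply: le_trans bx; exact: ler_piMl.
have c1 := cos_max (angle R n k); have s1 := sin_max (angle R n k).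
have s1' : `|- sin (angle R n k)| <= 1 by rewrite normrN.
rewrite /= mxE; case: j => -[|[|[|[|j]]]] jP //=; rewrite -?mulNr; apply: key => //;
  exact: mx_entry_norm.
Qed.

Lemma rotation_continuous k : continuous (@rotation R n k).
Proof. exact: (bounded_linear_continuous (rotation_linear k) (rotation_bounded k)). Qed.

Lemma derive_rotation k x v : 'D_v (@rotation R n k) x = rotation k v.
Proof.
have := @derive_affine R V V V id (@rotation R n k) x v (rotation k v).
by rewrite derive_id; apply=> h; exact: rotation_linear.
Qed.

Lemma rotation_cis k x : rotation k x =
  \row_(j < 4) [:: complex.Re (unit_root R n k * (x 0 cx +i* x 0 cy));
                   complex.Im (unit_root R n k * (x 0 cx +i* x 0 cy));
                   complex.Re (unit_root R n k * (x 0 cpx +i* x 0 cpy));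
                   complex.Im (unit_root R n k * (x 0 cpx +i* x 0 cpy))]`_j.
Proof.
apply/rowP => j; rewrite !mxE.
by case: j => -[|[|[|[|j]]]] jP //=; ring.
Qed.

Lemma rotation0 x : rotation (0 : 'Z_n) x = x.
Proof.
rewrite rotation_cis unit_root0 //; apply/rowP => j; rewrite mxE !mul1r.
by case: j => -[|[|[|[|j]]]] jP //=; congr (x 0 _); exact: val_inj.
Qed.

Lemma rotationD k l x : rotation (k + l) x = rotation k (rotation l x).
Proof.
have E : unit_root R n (k + l)%R = unit_root R n k * unit_root R n l.
  by rewrite val_Zp_add // -[X in unit_root R n X]mul1n unit_root_mod // mul1n unit_rootD.
have := congr1 (@complex.Re R) E; have := congr1 (@complex.Im R) E.
rewrite cReM cImM /= => Es Ec.
apply/rowP => j; rewrite !mxE /= Es Ec.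
by case: j => -[|[|[|[|j]]]] jP //=; ring.
Qed.

Lemma rotationK k : cancel (@rotation R n k) (rotation (- k)).
Proof. by move=> x; rewrite -rotationD addNr rotation0. Qed.

Lemma rotationNK k : cancel (@rotation R n (- k)) (rotation k).
Proof. by move=> x; rewrite -rotationD addrN rotation0. Qed.

Lemma rotation_open k (W : set V) : open W -> open (@rotation R n k @` W).
Proof.
move=> oW; have -> : @rotation R n k @` W = @rotation R n (- k) @^-1` W.
  apply/seteqP; split=> [_ [x Wx <-] /=|y /= Wy]; first by rewrite rotationK.
  by exists (rotation (- k) y) => //; exact: rotationNK.
exact: ((continuousP _).1 (@rotation_continuous (- k))).
Qed.

End Rotations.

(** * Bundles given by a connection form; twisting *)

Section GaugeBundle.
Variable R : realType.
Local Notation C := R[i].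
Local Notation V := (phase R).
Variable A : V -> V -> C.
Hypothesis A_smooth : forall v, csmooth_on setT (A v).
Hypothesis A_imaginary : forall v x, A v x + Num.conj (A v x) = 0.
Hypothesis A_linear : forall (a : R) u v x, A (a *: u + v) x = a%:C * A u x + A v x.

(** The trivial bundle with connection d + A. The symmetric gauge gives the prequantum bundle, and A
    = 0 the bundle underlying every F_a. *)
Definition gauge_bundle : line_bundle R :=
  {| fib := fun _ => C^o : vectType C;
     herm := fun _ => @cdot R : {dot C^o for @Num.conj C};
     frame := fun U e => U = setT /\ e = (fun=> 1);
     nabla := fun v s x => cderive v s x + A v x * s x |}.

Lemma smooth_gauge_section U (s : V -> C) : open U ->
  @smooth_section R gauge_bundle U s <-> csmooth_on U s.
Proof.
move=> oU; split=> [ss|ss W e [-> ->]].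
  have := ss setT (fun=> 1) (conj erefl erefl); rewrite setIT => h.
  by apply: (csmooth_on_ext oU _ h) => x _; rewrite /= /cdot rmorph1 mulr1.
rewrite setIT; apply: (csmooth_on_ext oU _ ss) => x _.
by rewrite /= /cdot rmorph1 mulr1.
Qed.

Lemma gauge_line_bundle : is_line_bundle gauge_bundle.
Proof.
have sA U v : csmooth_on U (A v) by apply: csmooth_on_sub (A_smooth v).
split.
- by move=> x; rewrite dimvf.
- by move=> U e [-> _]; exact: openT.
- by move=> U e [_ ->] x _; rewrite /= /cdot mul1r rmorph1.
- by move=> x; exists setT, (fun=> 1).
- move=> U e [-> ->]; apply/(smooth_gauge_section _ openT); exact: csmooth_on_cst.
- move=> U s v oU /(smooth_gauge_section _ oU) ss; apply/(smooth_gauge_section _ oU).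
  exact: (csmooth_onD oU (csmooth_on_cderive v ss) (csmooth_onM oU (sA U v) ss)).
- move=> U s t v oU _ st x Ux /=; rewrite (st x Ux); congr (_ + _).
  exact: (cderive_ext v oU Ux).
- move=> U s t v oU /(smooth_gauge_section _ oU) ss /(smooth_gauge_section _ oU) st x Ux /=.
  by rewrite (cderiveD v ss st Ux) mulrDr addrACA.
- move=> U f s v oU sf /(smooth_gauge_section _ oU) ss x Ux /=.
  rewrite (cderiveM v sf ss Ux) -![_ *: _]/(_ * _) mulrDr addrA; congr (_ + _).
  by rewrite mulrCA.
- move=> U s a u v oU /(smooth_gauge_section _ oU) ss x Ux /=.
  rewrite (cderive_linear u v a oU ss Ux) A_linear -![_ *: _]/(_ * _).
  by rewrite mulrDr mulrDl addrACA mulrA.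
- move=> U s t v oU /(smooth_gauge_section _ oU) ss /(smooth_gauge_section _ oU) st x Ux /=.
  rewrite /cdot (cderiveM v ss (csmooth_on_conj oU st) Ux) (cderive_conj v st Ux).
  rewrite !rmorphD rmorphM /= mulrDl mulrDr addrACA.
  have -> : Num.conj (A v x) = - A v x by apply/eqP; rewrite -addr_eq0 addrC A_imaginary.
  by rewrite mulNr mulrN mulrCA mulrA addrC subrr add0r.
Qed.

Lemma gauge_curvature :
  has_curvature gauge_bundle (fun x u v => cderive u (A v) x - cderive v (A u) x).
Proof.
move=> U s oU /(smooth_gauge_section _ oU) ss x Ux u v /=.
have sA w : csmooth_on U (A w) by apply: csmooth_on_sub (A_smooth w).
have E w z : cderive w (fun y => cderive z s y + A z y * s y) x =
    cderive w (cderive z s) x + (cderive w (A z) x * s x + A z x * cderive w s x).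
  rewrite (cderiveD w (csmooth_on_cderive z ss) (csmooth_onM oU (sA z) ss) Ux).
  by rewrite (cderiveM w (sA z) ss Ux).
rewrite !E (cderive_comm u v oU ss Ux) -[_ *: _]/(_ * _).
move: (cderive _ _ _) (cderive _ _ _) (cderive _ _ _) (cderive _ _ _) (cderive _ _ _).
by move: (A _ _) (A _ _) (s x) => *; ring.
Qed.

Variable n : nat.
Hypothesis n2 : (2 <= n)%N.
Hypothesis A_invariant : forall (k : 'Z_n) v x, A (rotation k v) (rotation k x) = A v x.

Definition gauge_eq_bundle : eq_line_bundle R n :=
  @EqLineBundle R n gauge_bundle (fun k x (u : C^o) => u).

Lemma total_point_gauge x y (u : C^o) : x = y ->
  @total_point R gauge_bundle x u = @total_point R gauge_bundle y u.
Proof. by move=> ->. Qed.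

Lemma gauge_is_eq_line_bundle : is_eq_line_bundle gauge_eq_bundle.
Proof.
split.
- exact: gauge_line_bundle.
- by move=> x u /=; apply: total_point_gauge; exact: rotation0.
- by move=> k l x u /=; apply: total_point_gauge; exact: rotationD.
- move=> k.
  have key U (s t : V -> C) : open U -> (forall x, U x -> t (rotation k x) = s x) ->
      forall y, (@rotation R n k @` U) y -> s (rotation (- k) y) = t y.
    by move=> oU tE _ [x Ux <-]; rewrite rotationK // tE.
  split.
  + by move=> x a u v.
  + by [].
  + move=> U s t oU tE /(smooth_gauge_section _ oU) ss; have oW := @rotation_open R n n2 k U oU.
    apply/(smooth_gauge_section _ oW); apply: (csmooth_on_ext oW (key U s t oU tE)).
    have := csmooth_on_comp_linear (@rotation_linear R n (- k))
      (@rotation_continuous R n (- k)) ss.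
    by apply: csmooth_on_sub => _ [x Ux <-] /=; rewrite rotationK.
  + move=> U s t oU tE /(smooth_gauge_section _ oU) ss x Ux v /=.
    rewrite derive_rotation A_invariant tE //; congr (_ + _).
    rewrite -(cderive_comp_linear t v x (@rotation_linear R n k)).
    by apply: (cderive_ext v oU Ux) => y Uy /=; rewrite tE.
Qed.

End GaugeBundle.

Section Twist.
Variables (R : realType) (n : nat).
Hypothesis n2 : (2 <= n)%N.
Local Notation C := R[i].
Local Notation V := (phase R).

(** A model of E (x) F_a on the bundle [E] itself, obtained by identifying the tensor product of a
    fibre with the complex line with that fibre. *)
Definition twist (a : nat) (E : eq_line_bundle R n) : eq_line_bundle R n :=
  @EqLineBundle R n (bundle E)
    (fun k x u => unit_root R n (a * k)%N *: lift_action k u).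

(** Scaling as a map of the total space: equalities such as [lift_D] are scaled through it without
    any cast between fibres. *)
Definition total_scale (L : line_bundle R) (c : C) (p : {y : V & fib L y}) :
  {y : V & fib L y} := total_point (c *: projT2 p).

Lemma lift_actionZ (E : eq_line_bundle R n) k x (c : C) (u : fib E x) :
  is_eq_line_bundle E -> lift_action k (c *: u) = c *: lift_action k u.
Proof.
move=> HE; have HP := @bundle_map_local R _ _ _ _ setT (lift_map HE k).
exact: (local_mapZ c u HP).
Qed.

Lemma twist_is_eq_line_bundle a E : is_eq_line_bundle E -> is_eq_line_bundle (twist a E).
Proof.
move=> HE; split.
- exact: (eq_bundle HE).
- move=> x u /=; rewrite muln0 unit_root0 // scale1r; exact: (lift_0 HE).
- move=> k l x u /=.
  have -> : unit_root R n (a * (k + l)%R) = unit_root R n (a * l) * unit_root R n (a * k).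
    by rewrite val_Zp_add // unit_root_mod // mulnDr unit_rootD mulrC.
  rewrite lift_actionZ // scalerA mulrC.
  by have := congr1 (total_scale (unit_root R n (a * k) * unit_root R n (a * l)))
    (lift_D HE k l u).
- move=> k; apply: bundle_map_scale (lift_map HE k).
  + exact: (eq_bundle HE).
  + by move=> W; exact: rotation_open.
  + exact: unit_root_conj.
Qed.

End Twist.

(** * The curvature under isomorphisms; a prequantum bundle *)

Section Curvature.
Variable R : realType.
Local Notation C := R[i].
Local Notation V := (phase R).
Variables (L L' : line_bundle R) (Phi : forall x, fib L x -> fib L' x).
Hypotheses (HL : is_line_bundle L) (HL' : is_line_bundle L').
Hypothesis HP : @is_bundle_map R L L' id Phi.

Lemma bundle_mapZ x (c : C) (u : fib L x) : Phi (c *: u) = c *: Phi u.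
Proof. exact: (local_mapZ c u (@bundle_map_local R L L' id _ setT HP)). Qed.

Lemma bundle_map_inj x : injective (@Phi x).
Proof.
move=> u v E; have [e e1] := unit_section HL.
rewrite (line_span HL u (e1 x)) (line_span HL v (e1 x)).
by rewrite -(map_unitary HP u) -(map_unitary HP v) E.
Qed.

Lemma curvature_of_map U (s : section L) (t : section L') x u v : open U ->
  (forall y, U y -> t y = Phi (s y)) -> smooth_section U s -> U x ->
  nabla u (nabla v t) x - nabla v (nabla u t) x =
  Phi (nabla u (nabla v s) x - nabla v (nabla u s) x).
Proof.
move=> oU tE ss Ux.
have D w y : U y -> nabla w t y = Phi (nabla w s y).
  by move=> Uy; have := map_parallel HP oU tE ss Uy w; rewrite derive_id.
have DD w z : nabla w (nabla z t) x = Phi (nabla w (nabla z s) x).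
  by have := map_parallel HP oU (D z) (nabla_smooth HL z oU ss) Ux w; rewrite derive_id.
rewrite !DD; have := map_linear HP (-1) (nabla v (nabla u s) x) (nabla u (nabla v s) x).
by rewrite !scaleN1r ![- _ + _]addrC.
Qed.

(** This replaces an inverse bundle map: the coefficient of [t] in the image of a local frame of [L]
    is reused in that frame. *)
Lemma lift_smooth_section U (t : section L') x : open U -> U x ->
  smooth_section U t -> exists W, exists s : section L,
  [/\ open W, W x, W `<=` U, smooth_section W s & forall y, W y -> t y = Phi (s y)].
Proof.
move=> oU Ux st; have [W [e [oW Wx fe se e1]]] := local_frame HL x.
have oUW := openI oU oW.
have [WU WW] : U `&` W `<=` U /\ U `&` W `<=` W by split=> ? [].
have sPe : smooth_section (U `&` W) (fun y => Phi (e y) : fib L' y).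
  have := map_smooth HP (t := fun y => Phi (e y)) oUW (fun y _ => erefl) (smooth_section_sub WW se).
  by rewrite image_id.
have Pe1 y : (U `&` W) y -> herm L' y (Phi (e y)) (Phi (e y)) = 1.
  by move=> [_ Wy]; rewrite (map_unitary HP) e1.
exists (U `&` W), (fun y => herm L' y (t y) (Phi (e y)) *: e y); split => //.
  apply: (smooth_sectionZ HL oUW _ (smooth_section_sub WW se)).
  exact: (smooth_section_dot HL' oUW (smooth_section_sub WU st) sPe).
by move=> y Wy; rewrite bundle_mapZ; exact: (line_span HL' _ (Pe1 y Wy)).
Qed.

(** From left to right sections of [L'] are lifted locally; from right to left sections of [L] are
    pushed forward and injectivity of [Phi] on fibres concludes. *)
Lemma has_curvature_map F : has_curvature L F <-> has_curvature L' F.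
Proof.
split=> HF U.
  move=> t oU st x Ux u v.
  have [W [s [oW Wx WU ss tE]]] := lift_smooth_section oU Ux st.
  rewrite (curvature_of_map u v oW tE ss Wx) (HF W s oW ss x Wx u v).
  by rewrite bundle_mapZ tE.
move=> s oU ss x Ux u v; apply: bundle_map_inj.
rewrite -(@curvature_of_map U s (fun y => Phi (s y)) x u v oU (fun y _ => erefl) ss Ux).
rewrite bundle_mapZ.
apply: (HF U (fun y => Phi (s y)) oU _ x Ux u v).
by have := map_smooth HP (t := fun y => Phi (s y)) oU (fun y _ => erefl) ss; rewrite image_id.
Qed.

End Curvature.

Section Prequantum.
Variables (R : realType) (n : nat) (hbar : R).
Hypothesis n2 : (2 <= n)%N.
Local Notation C := R[i].
Local Notation V := (phase R).

(* The derivative of [omega x v] in [x] along [u] is [omega u v], and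
   antisymmetrizing in [u] and [v] doubles it: hence the factor 1/2. *)
Definition symmetric_gauge (v x : V) : C := 'i%C * (- (2 * hbar)^-1 * omega x v)%:C.

Lemma omega_smooth U v : open U -> smooth_on U (fun x : V => omega x v).
Proof.
move=> oU; have cc i (a : R) : smooth_on U (fun x : V => x 0 i * a).
  exact: (smooth_onM oU (@smooth_on_coord R U i) (@smooth_on_cst R U a)).
apply: (smooth_onD oU).
  apply: (smooth_on_ext oU _ (smooth_onB oU (cc cpx (v 0 cx)) (cc cx (v 0 cpx)))).
  by move=> x _; rewrite (mulrC (v 0 cpx)).
apply: (smooth_on_ext oU _ (smooth_onB oU (cc cpy (v 0 cy)) (cc cy (v 0 cpy)))).
by move=> x _; rewrite (mulrC (v 0 cpy)).
Qed.

Lemma omega_linearl (h : R) (u x v : V) : omega (h *: u + x) v = h * omega u v + omega x v.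
Proof. by rewrite /omega !mxE; ring. Qed.

Lemma omegaC (u v : V) : omega u v = - omega v u.
Proof. by rewrite /omega; ring. Qed.

Lemma omega_linearr (h : R) (u v x : V) : omega x (h *: u + v) = h * omega x u + omega x v.
Proof. by rewrite omegaC omega_linearl !(omegaC _ x); ring. Qed.

Lemma omega_rotation (k : 'Z_n) (u v : V) : omega (rotation k u) (rotation k v) = omega u v.
Proof.
rewrite /omega !mxE /=; move: (cos2Dsin2 (angle R n k)).
move: (cos _) (sin _) => c s cs.
(* The right-hand side is multiplied by cos^2 + sin^2 = 1, after which both sides are the same
   polynomial. *)
by rewrite -[RHS]mul1r -cs; ring.
Qed.

Lemma derive_omega (u v x : V) : 'D_u (fun y : V => omega y v) x = omega u v.
Proof.
have := @derive_affine R R V R id (fun y : V => omega y v) x u (omega u v).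
rewrite derive_id; apply=> h; exact: omega_linearl.
Qed.

Lemma symmetric_gauge_smooth v : csmooth_on setT (symmetric_gauge v).
Proof.
have oT := @openT V.
have sw := smooth_onM oT (@smooth_on_cst R setT (- (2 * hbar)^-1)) (omega_smooth v oT).
split; [apply: (smooth_on_ext oT _ (@smooth_on_cst R setT 0))|apply: (smooth_on_ext oT _ sw)].
  by move=> x _; rewrite /symmetric_gauge cReM /=; ring.
by move=> x _; rewrite /symmetric_gauge cImM /=; ring.
Qed.

Lemma symmetric_gauge_imaginary v x :
  symmetric_gauge v x + Num.conj (symmetric_gauge v x) = 0.
Proof.
apply: complex_eqP; rewrite ?cReD ?cImD ?cRe_conj ?cIm_conj ?cReM ?cImM /=; ring.
Qed.

Lemma symmetric_gauge_linear (a : R) u v x :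
  symmetric_gauge (a *: u + v) x = a%:C * symmetric_gauge u x + symmetric_gauge v x.
Proof.
rewrite /symmetric_gauge omega_linearr.
apply: complex_eqP; rewrite ?cReD ?cImD ?cReM ?cImM /=; ring.
Qed.

Lemma symmetric_gauge_invariant (k : 'Z_n) v x :
  symmetric_gauge (rotation k v) (rotation k x) = symmetric_gauge v x.
Proof. by rewrite /symmetric_gauge omega_rotation. Qed.

Lemma symmetric_gauge_curvature x u v :
  cderive u (symmetric_gauge v) x - cderive v (symmetric_gauge u) x =
  - 'i%C / hbar%:C * (omega u v)%:C.
Proof.
have D w z : cderive w (symmetric_gauge z) x = 'i%C * (- (2 * hbar)^-1 * omega w z)%:C.
  have Er : (fun y => complex.Re (symmetric_gauge z y)) = cst 0.
    by apply/funext => y; rewrite /symmetric_gauge cReM /=; ring.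
  have Ei : (fun y => complex.Im (symmetric_gauge z y)) =
      - (2 * hbar)^-1 \*: (fun y : V => omega y z).
    by apply/funext => y; rewrite /symmetric_gauge cImM /= -[_ *: _]/(_ * _); ring.
  have dz := @smooth_on_derivable R setT _ x w (omega_smooth z openT) I.
  rewrite /cderive Er Ei derive_cst (deriveZ _ dz) derive_omega.
  by apply: complex_eqP; rewrite ?cReM ?cImM /= -?[_ *: _]/(_ * _); ring.
rewrite !D (omegaC v u) -mulrBr -rmorphB /= mulrN opprK -mulrDr.
have -> : - (2 * hbar)^-1 * (omega u v + omega u v) = - hbar^-1 * omega u v.
  by rewrite invfM; move: hbar^-1 => h; field.
by rewrite rmorphM rmorphN /= fmorphV; ring.
Qed.

Definition standard_bundle : eq_line_bundle R n := gauge_eq_bundle symmetric_gauge n.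

Lemma standard_prequantum : is_prequantum hbar standard_bundle.
Proof.
split.
  exact: (gauge_is_eq_line_bundle symmetric_gauge_smooth symmetric_gauge_imaginary
    symmetric_gauge_linear n2 symmetric_gauge_invariant).
move=> U s oU ss x Ux u v.
rewrite (gauge_curvature symmetric_gauge_smooth oU ss Ux).
by rewrite symmetric_gauge_curvature.
Qed.

End Prequantum.

(** * The flat bundles *)

Section ScaleBilinear.
Variables (R : realType) (T : lmodType R[i]).
Local Notation C := R[i].

(** The bilinear map that exhibits [twist] as a tensor product; the scalar is the second argument
    because F_a is the second factor. *)
Definition rscale (u : T) (c : C^o) : T := c *: u.

Fact rscale_is_bilinear :
  bilinear_for (GRing.Scale.Law.clone _ _ ( *:%R ) _)
    (GRing.Scale.Law.clone _ _ ( *:%R ) _) rscale.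
Proof.
split=> [c a u v|u a c d] /=; rewrite /rscale.
  by rewrite scalerDr !scalerA mulrC.
by rewrite scalerDl scalerA.
Qed.

HB.instance Definition _ :=
  bilinear_isBilinear.Build C T C^o T *:%R *:%R rscale rscale_is_bilinear.

End ScaleBilinear.

Section FlatBundles.
Variables (R : realType) (n : nat).
Hypothesis n2 : (2 <= n)%N.
Local Notation C := R[i].
Local Notation V := (phase R).

(** The records differ only by a term 0 * s in the connection, so F_a inherits all the results on
    gauge bundles and twists. *)
Lemma flat_bundleE a :
  flat_bundle R n a = twist a (gauge_eq_bundle (fun _ _ => 0) n).
Proof.
pose E nb := @EqLineBundle R n
  {| fib := fun _ => C^o : vectType C;
     herm := fun _ => @cdot R : {dot C^o for @Num.conj C};
     frame := fun U e => U = setT /\ e = (fun=> 1);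
     nabla := nb |}
  (fun k _ (u : C^o) => unit_root R n (a * k)%N * u).
change (E (@nabla R (trivial_bundle R)) = E (@nabla R (gauge_bundle (fun _ _ => 0)))).
congr (E _); apply/funext => v; apply/funext => s; apply/funext => x /=.
by rewrite mul0r addr0.
Qed.

Let zero_smooth (v : V) : csmooth_on setT ((fun _ _ => 0) v : V -> C).
Proof. exact: csmooth_on_cst. Qed.

Let zero_imaginary (v x : V) : (0 : C) + Num.conj 0 = 0.
Proof. by rewrite rmorph0 addr0. Qed.

Let zero_linear (a : R) (u v x : V) : (0 : C) = a%:C * 0 + 0.
Proof. by rewrite mulr0 addr0. Qed.

Lemma flat_is_eq_line_bundle a : is_eq_line_bundle (flat_bundle R n a).
Proof.
rewrite flat_bundleE; apply: (twist_is_eq_line_bundle n2 a).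
by apply: (gauge_is_eq_line_bundle zero_smooth zero_imaginary zero_linear n2).
Qed.

Lemma flat_curvature a : has_curvature (flat_bundle R n a) (fun _ _ _ => 0).
Proof.
rewrite flat_bundleE => U s oU ss x Ux u v.
apply: etrans (gauge_curvature zero_smooth oU ss Ux u v) _.
have cst0 w : cderive w (fun _ : V => 0 : C) x = 0 := cderive_cst w 0 x.
by rewrite (cst0 u) (cst0 v) subrr.
Qed.

Lemma smooth_flat_section a U (s : V -> C) : open U ->
  @smooth_section R (flat_bundle R n a) U s <-> csmooth_on U s.
Proof. exact: (@smooth_gauge_section R (fun _ _ => 0)). Qed.

Lemma twist_is_tensor a (E : eq_line_bundle R n) : is_eq_line_bundle E ->
  is_tensor E (flat_bundle R n a) (twist a E).
Proof.
move=> HE; have HL := eq_bundle HE.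
split; first exact: twist_is_eq_line_bundle.
exists (fun x => @rscale R (fib E x) : {bilinear fib E x -> C^o -> fib E x}); split.
- move=> x u v u' v' /=; rewrite /rscale dotZl dotZr /cdot mulrA.
  by rewrite mulrC.
- move=> U s s' oU ss /(smooth_flat_section _ _ oU) ss'.
  exact: (smooth_sectionZ HL oU ss' ss).
- move=> U s s' oU ss /(smooth_flat_section _ _ oU) ss' v x Ux.
  rewrite /= /rscale (nabla_scale HL v oU ss' ss Ux) addrC.
  by [].
- move=> k x u u' /=; rewrite /rscale lift_actionZ // !scalerA.
  by [].
Qed.

(** F_b (x) F_a = F_(b + a) holds as an equality of records, which lets tensor powers be computed by
    rewriting. *)
Lemma twist_flat a b : twist a (flat_bundle R n b) = flat_bundle R n (b + a).
Proof.
pose E (f : 'Z_n -> V -> C^o -> C^o) := @EqLineBundle R n (trivial_bundle R) f.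
change (E (fun k _ u => unit_root R n (a * k) * (unit_root R n (b * k) * u)) =
        E (fun k _ u => unit_root R n ((b + a) * k) * u)).
congr (E _); apply/funext => k; apply/funext => x; apply/funext => u.
by rewrite mulrA mulnDl unit_rootD (mulrC (unit_root R n (b * k))).
Qed.

Lemma eq_iso_refl (E : eq_line_bundle R n) : is_eq_line_bundle E -> eq_iso E E.
Proof.
move=> HE; exists (fun x u => u); split=> //; split => //.
- move=> U s t oU tE ss; rewrite image_id.
  by apply: (smooth_section_ext (eq_bundle HE) oU _ ss) => x Ux; exact: esym (tE x Ux).
- move=> U s t oU tE ss x Ux v; rewrite derive_id; apply: esym.
  by apply: (nabla_ext (eq_bundle HE) v oU ss _ Ux) => y Uy; exact: esym (tE y Uy).
Qed.

Lemma flat_tensor_power a m :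
  is_tensor_power (flat_bundle R n a) m (flat_bundle R n (m * a)).
Proof.
elim: m => [|m IH] /=; first exact/eq_iso_refl/flat_is_eq_line_bundle.
exists (flat_bundle R n (m * a)); split; first exact: IH.
rewrite mulSn addnC -twist_flat; apply: twist_is_tensor.
exact: flat_is_eq_line_bundle.
Qed.

Lemma flat_torsion a :
  is_tensor_power (flat_bundle R n a) n (flat_bundle R n 0).
Proof.
have := flat_tensor_power a n.
suff -> : flat_bundle R n (n * a) = flat_bundle R n 0 by [].
pose E (f : 'Z_n -> V -> C^o -> C^o) := @EqLineBundle R n (trivial_bundle R) f.
change (E (fun k _ u => unit_root R n (n * a * k) * u) =
        E (fun k _ u => unit_root R n (0 * k) * u)).
congr (E _); apply/funext => k; apply/funext => x; apply/funext => u.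
by rewrite -mulnA unit_rootM unit_rootn // expr1n unit_root0.
Qed.

End FlatBundles.

(** * The character comparing two lifts *)

Section Sectors.
Variables (R : realType) (n : nat).
Hypothesis n2 : (2 <= n)%N.
Local Notation C := R[i].
Local Notation V := (phase R).
Implicit Types E : eq_line_bundle R n.

Lemma convex_setT : convex_subset [set: V].
Proof. by []. Qed.

(** The map is u -> u (x) 1. The section 1 of F_a has norm 1 and zero covariant derivative, so the
    map is isometric and parallel; the lift multiplies 1 by chi_a, whence the factor. *)
Lemma tensor_flat_map a E T : is_eq_line_bundle E ->
  is_tensor E (flat_bundle R n a) T ->
  exists Phi : forall x, fib E x -> fib T x, @is_bundle_map R E T id Phi /\
    forall (k : 'Z_n) x (u : fib E x),
      lift_action k (Phi x u) =
      unit_root R n (a * k)%N *: Phi (rotation k x) (lift_action k u).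
Proof.
move=> HE [HT [m [m_herm m_smooth m_nabla m_lift]]].
pose one : section (flat_bundle R n a) := fun=> 1 : C^o.
have sone U : open U -> @smooth_section R (flat_bundle R n a) U one.
  by move=> oU; apply/(@smooth_flat_section R n a U one oU); exact: csmooth_on_cst.
exists (fun x u => m x u (one x)); split.
  split.
  - by move=> x k u v; rewrite linearDl linearZl_LR.
  - by move=> x u v /=; rewrite m_herm /= /cdot mul1r rmorph1 mulr1.
  - move=> U s t oU tE ss; rewrite image_id.
    apply: (smooth_section_ext (eq_bundle HT) oU _ (m_smooth U s one oU ss (sone U oU))).
    by move=> x Ux; exact: esym (tE x Ux).
  - move=> U s t oU tE ss x Ux v; rewrite derive_id /=.
    have st := m_smooth U s one oU ss (sone U oU).
    have -> : nabla v t x = nabla v (fun y => m y (s y) (one y)) x.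
      apply/esym/(nabla_ext (eq_bundle HT) v oU st _ Ux) => y Uy.
      exact: esym (tE y Uy).
    rewrite (m_nabla U s one oU ss (sone U oU) v x Ux).
    have -> : nabla v one x = 0 :> C^o by exact: cderive_cst.
    by rewrite linear0r addr0.
move=> k x u; rewrite m_lift /=.
have -> : unit_root R n (a * k) * one x = unit_root R n (a * k) *: (one (rotation k x) : C^o) by [].
by rewrite linearZr_LR.
Qed.

(** Both sides are parallel isometries covering the same rotation, so their ratio is constant on the
    whole, convex, base. *)
Lemma rotation_ratio E E' (Psi : forall x, fib E x -> fib E' x) :
  is_eq_line_bundle E -> is_eq_line_bundle E' -> @is_bundle_map R E E' id Psi ->
  exists c : 'Z_n -> C, forall k x (u : fib E x),
    Psi (rotation k x) (lift_action k u) = c k *: lift_action k (Psi x u).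
Proof.
move=> HE HE' HP.
suff H k : exists c : C, forall x (u : fib E x),
    Psi (rotation k x) (lift_action k u) = c *: lift_action k (Psi x u).
  by have [c cE] := choice H; exists c.
have fK := @rotationK R n n2 k; have gK := @rotationNK R n n2 k.
have fo := @rotation_open R n n2 k.
have io (W : set V) : open W -> open (id @` W) by rewrite image_id.
have chain1 (x v : V) : 'D_v (id \o @rotation R n k) x =
    'D_('D_v (@rotation R n k) x) id (rotation k x) by rewrite derive_id.
have chain2 (x v : V) : 'D_v (@rotation R n k \o id) x =
    'D_('D_v id x) (@rotation R n k) (id x) by rewrite derive_id.
have H1 := bundle_map_comp fK gK fo chain1 (lift_map HE k) HP.
have H2 := bundle_map_comp (fun _ => erefl) (fun _ => erefl) io chain2 HP (lift_map HE' k).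
have surj (x w : V) : exists v, 'D_v (@rotation R n k) x = w.
  by exists (rotation (- k) w); rewrite derive_rotation; exact: gK.
have full : @rotation R n k @` setT = setT.
  by apply/seteqP; split=> // y _; exists (rotation (- k) y) => //; exact: gK.
have cT : convex_subset (@rotation R n k @` setT) by rewrite full.
have [c cE] := local_map_ratio fK gK (eq_bundle HE) (eq_bundle HE') fo surj openT cT
  (bundle_map_local setT H1) (bundle_map_local setT H2).
by exists c => x u; exact: (cE x I u).
Qed.

Lemma total_scale_inj (L : line_bundle R) x (c c' : C) (u : fib L x) :
  is_line_bundle L -> u != 0 ->
  total_point (c *: u) = total_point (c' *: u) -> c = c'.
Proof.
move=> HL u0; have [e e1] := unit_section HL.
(* Pairing with a global unit section is a function on the whole total space, so it applies to the
   equality without a cast. *)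
move/(congr1 (fun p : {y : V & fib L y} => herm L (projT1 p) (projT2 p) (e (projT1 p)))) => /=.
rewrite !dotZl; apply: mulIf; apply: contra_neq u0 => h0.
by rewrite (line_span HL u (e1 x)) h0 scale0r.
Qed.

Lemma bundle_map_neq0 (L L' : line_bundle R) f (Phi : forall x, fib L x -> fib L' (f x)) x
    (u : fib L x) : is_bundle_map Phi -> herm L x u u = 1 -> Phi x u != 0.
Proof. by move=> HP u1; apply: (@dot1_neq0 _ _ (herm L' (f x))); rewrite (map_unitary HP). Qed.

(** The constants can be compared on the single unit vector [e 0]: the laws of the two lifts make
    them multiplicative, so [c 1] determines them all. *)
Lemma rotation_ratio_character E E' (Psi : forall x, fib E x -> fib E' x) :
  is_eq_line_bundle E -> is_eq_line_bundle E' -> @is_bundle_map R E E' id Psi ->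
  exists2 a : nat, (a < n)%N & forall k x (u : fib E x),
    Psi (rotation k x) (lift_action k u) =
    unit_root R n (a * k) *: lift_action k (Psi x u).
Proof.
move=> HE HE' HP; have [c cE] := rotation_ratio HE HE' HP.
have HL := eq_bundle HE; have HL' := eq_bundle HE'.
have [e e1] := unit_section HL.
(* [lift_0] and [lift_D] are equalities in the total space: they are transported
   along the map [tPsi] of total spaces. *)
pose tPsi (p : {y : V & fib E y}) := total_point (Psi _ (projT2 p)).
have lift_neq0 k x (u : fib E' x) : herm E' x u u = 1 -> lift_action k u != 0.
  exact: bundle_map_neq0 (lift_map HE' k).
have unitP x (u : fib E x) : herm E x u u = 1 -> herm E' x (Psi x u) (Psi x u) = 1.
  by move=> <-; rewrite -[in RHS](map_unitary HP).
have c0 : c 0 = 1.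
  have := cE 0 0 (e 0) => /(congr1 (@total_point R E' _)).
  have -> : total_point (Psi (rotation 0 0) (lift_action 0 (e 0))) =
      tPsi (total_point (lift_action 0 (e 0))) by [].
  rewrite (lift_0 HE) => h.
  apply/esym/(@total_scale_inj E' _ _ _ (Psi 0 (e 0)) HL').
    by apply: (bundle_map_neq0 HP); exact: e1.
  rewrite scale1r; apply: etrans h _.
  have -> : total_point (c 0 *: lift_action 0 (Psi 0 (e 0))) =
      total_scale (c 0) (total_point (lift_action 0 (Psi 0 (e 0)))) by [].
  by rewrite (lift_0 HE').
have cD k l : c (k + l) = c k * c l.
  have := cE (k + l) 0 (e 0) => /(congr1 (@total_point R E' _)).
  have -> : total_point (Psi _ (lift_action (k + l) (e 0))) =
      tPsi (total_point (lift_action (k + l) (e 0))) by [].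
  rewrite (lift_D HE) /tPsi /= cE cE lift_actionZ // scalerA => h.
  apply/esym/(@total_scale_inj E' _ _ _ (lift_action k (lift_action l (Psi 0 (e 0)))) HL').
    apply: lift_neq0; rewrite (map_unitary (lift_map HE' l)); apply: unitP; exact: e1.
  apply: etrans h _.
  have -> : total_point (c (k + l) *: lift_action (k + l) (Psi 0 (e 0))) =
      total_scale (c (k + l)) (total_point (lift_action (k + l) (Psi 0 (e 0)))) by [].
  by rewrite (lift_D HE').
have cX m : c (m%:R) = c 1 ^+ m.
  by elim: m => [|m IH]; rewrite ?c0 // mulrS cD IH exprS.
(* In ['Z_n] the image of [n] is 0, where [c] equals 1. *)
have cn : c 1 ^+ n = 1.
  by rewrite -cX (pchar_Zp n2) c0.
have [a an c1E] := unity_root_unit_root n2 cn.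
exists a => // k x u; rewrite cE; congr (_ *: _).
by rewrite -[in LHS](natr_Zp k) cX c1E unit_rootM.
Qed.

End Sectors.

(** * The list of sectors built from one prequantum bundle *)

Section TensorSectors.
Variables (R : realType) (n : nat) (hbar : R).
Hypothesis n2 : (2 <= n)%N.
Variable L0 : eq_line_bundle R n.
Hypothesis HL0 : is_prequantum hbar L0.
Variable L : 'I_n -> eq_line_bundle R n.
Hypothesis HL : forall a : 'I_n, is_tensor L0 (flat_bundle R n a) (L a).

Let L0_eq : is_eq_line_bundle L0. Proof. by case: HL0. Qed.
Let L_eq a : is_eq_line_bundle (L a). Proof. by case: (HL a). Qed.

Lemma tensor_prequantum a : is_prequantum hbar (L a).
Proof.
split; first exact: L_eq.
have [Phi [HP _]] := tensor_flat_map L0_eq (HL a).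
by apply/(has_curvature_map (eq_bundle L0_eq) (eq_bundle (L_eq a)) HP); case: HL0.
Qed.

(** An isomorphism composed with u -> u (x) 1 into L_a is a constant multiple of u -> u (x) 1 into
    L_b. Comparing their behaviour under the generator [g] on one nonzero vector gives chi_a(g) =
    chi_b(g). *)
Lemma tensor_distinct a b : eq_iso (L a) (L b) -> a = b.
Proof.
move=> [Psi [HPsi PsiE]].
have [Pa [HPa PaE]] := tensor_flat_map L0_eq (HL a).
have [Pb [HPb PbE]] := tensor_flat_map L0_eq (HL b).
have HPc := bundle_map_comp_id HPa HPsi.
have [c cE] := local_map_ratio_id (eq_bundle L0_eq) (eq_bundle (L_eq b)) openT
  (@convex_setT R) (bundle_map_local setT HPc) (bundle_map_local setT HPb).
have {}cE x (u : fib L0 x) : Psi x (Pa x u) = c *: Pb x u by exact: (cE x I u).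
have [e e1] := unit_section (eq_bundle L0_eq).
pose g : 'Z_n := 1; pose w := lift_action g (e 0).
have w1 : herm L0 _ w w = 1 by rewrite (map_unitary (lift_map L0_eq g)) e1.
have cPb0 : c *: Pb _ w != 0.
  by rewrite -cE; apply: (bundle_map_neq0 HPsi); rewrite (map_unitary HPa).
have : unit_root R n (a * g) *: (c *: Pb _ w) =
       unit_root R n (b * g) *: (c *: Pb _ w).
  rewrite -{1}cE -(bundle_mapZ HPsi) -PaE PsiE cE lift_actionZ // PbE.
  by rewrite !scalerA mulrC.
rewrite val_Zp_1 // !muln1 => /eqP; rewrite -subr_eq0 -scalerBl scaler_eq0.
rewrite (negbTE cPb0) orbF subr_eq0 => /eqP E.
by apply: val_inj; apply: (unit_root_inj n2 _ _ E).
Qed.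

(** The parallel map is taken from [E] to [L0]: the character by which it fails to commute with the
    lifts is then the one absorbed by u -> u (x) 1 into the corresponding L_a. *)
Lemma tensor_exhaustive E : is_prequantum hbar E -> exists a, eq_iso E (L a).
Proof.
move=> [HE cE].
have [Psi HPsi] := same_curvature_isomorphic (eq_bundle HE) (eq_bundle L0_eq) cE (HL0.2).
have [a an aE] := rotation_ratio_character n2 HE L0_eq HPsi.
exists (Ordinal an); have [Pa [HPa PaE]] := tensor_flat_map L0_eq (HL (Ordinal an)).
exists (fun x u => Pa x (Psi x u)); split; first exact: (bundle_map_comp_id HPsi HPa).
by move=> k x u; rewrite aE (bundle_mapZ HPa) PaE.
Qed.

Lemma tensor_lists_sectors : lists_sectors hbar L.
Proof.
split; [exact: tensor_prequantum | exact: tensor_distinct | exact: tensor_exhaustive].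
Qed.

End TensorSectors.

Theorem proposition6p1 (R : realType) (n : nat) (hbar : R)
    (hn : (2 <= n)%N) (hhbar : 0 < hbar) :
  (* there are exactly n sectors *)
  (exists S : 'I_n -> eq_line_bundle R n, lists_sectors hbar S) /\
  (* every F_a is a flat equivariant line bundle, and it is torsion *)
  (forall a : 'I_n,
     [/\ is_eq_line_bundle (flat_bundle R n a),
         has_curvature (flat_bundle R n a) (fun _ _ _ => 0) &
         is_tensor_power (flat_bundle R n a) n (flat_bundle R n 0)]) /\
  (forall L0 : eq_line_bundle R n, is_prequantum hbar L0 ->
     (forall a : 'I_n,
        exists La : eq_line_bundle R n, is_tensor L0 (flat_bundle R n a) La) /\
     forall L : 'I_n -> eq_line_bundle R n,
       (forall a : 'I_n, is_tensor L0 (flat_bundle R n a) (L a)) ->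
       (* the sectors are the L_a = L_0 (x) F_a *)
       lists_sectors hbar L /\
       forall a : 'I_n,
         (* L_a and L_0 have the same curvature *)
         (forall F, has_curvature L0 F <-> has_curvature (L a) F) /\
         (* L_a and L_0 only differ by the twist of the action by chi_a *)
         exists Phi : forall x, fib L0 x -> fib (L a) x,
           @is_bundle_map R L0 (L a) id Phi /\
           forall (k : 'Z_n) x (u : fib L0 x),
             lift_action k (Phi x u) =
             unit_root R n (a * k)%N *: Phi (rotation k x) (lift_action k u)).
Proof.
split; [|split].
(* Existence of a list only needs one prequantum bundle: the symmetric gauge provides it, and its
   twists serve as the tensor products. *)
- have HS := @standard_prequantum R n hbar hn.
  exists (fun a => twist a (standard_bundle n hbar)).
  apply: (tensor_lists_sectors hn HS) => a.
  by apply: (twist_is_tensor hn a); case: HS.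
- move=> a; split.
  + exact: flat_is_eq_line_bundle.
  + exact: flat_curvature.
  + exact: flat_torsion.
- move=> L0 HL0; have HE : is_eq_line_bundle L0 by case: HL0.
  split=> [a|L HL]; first by exists (twist a L0); exact: (twist_is_tensor hn a HE).
  split; first exact: (tensor_lists_sectors hn HL0 HL).
  move=> a; have [Phi [HP PE]] := tensor_flat_map HE (HL a).
  have HLa : is_eq_line_bundle (L a) by case: (HL a).
  split; first by move=> F; exact: (has_curvature_map (eq_bundle HE) (eq_bundle HLa) HP).
  by exists Phi.
Qed.
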